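(* Let $n\ge 3$, let $a_{jk}$ ($j,k=1,\dots,n$) be real-valued locally integrable functions on $[t_0,\infty)$, and assume that for each $k=3,\dots,n$ the relation $\frac{a_{1k}(t)}{a_{12}(t)}$ is well defined on $[t_0,\infty)$ and is absolutely continuous on $[t_0,\infty)$. Consider the system $$\phi_j'=\sum_{k=1}^n a_{jk}(t)\phi_k,\quad j=1,\dots,n,\quad t\ge t_0. \quad (S)$$ Let $A(t)$, $B_k(t)$ ($k=3,\dots,n$) and $C(t)$ be the functions defined in the context. Assume $a_{12}(t)\ge 0$ for $t\ge t_0$. Then the following assertions are valid. 1. Suppose that for every $T\ge t_0$ and all $\sigma_3,\dots,\sigma_n\in\{0,1\}$ there exist $t_1=t_1(T,\sigma_3,\dots,\sigma_n)$ and $t_2=t_2(T,\sigma_3,\dots,\sigma_n)$ with $t_2>t_1\ge T$ such that A) $(-1)^{\sigma_k}B_k(t)\ge 0$ for $t\in[t_1,t_2]$ and $k=3,\dots,n$, and B) $\displaystyle\int_{t_1}^{t_2}\min\left[a_{12}(t)\exp\left\{-\int_{t_1}^{t}A(\tau)\,d\tau\right\},\ C(t)\exp\left\{\int_{t_1}^{t}A(\tau)\,d\tau\right\}\right]dt\ \ge\ \pi.$ Then the system (S) is suboscillatory. 2. Suppose that C) $B_k(t)\equiv 0$ for $t\ge t_0$ and $k=3,\dots,n$, and D) $\displaystyle\int_{t_0}^{+\infty}a_{12}(t)\exp\left\{-\int_{t_0}^{t}A(\tau)\,d\tau\right\}dt=\int_{t_0}^{+\infty}C(t)\exp\left\{\int_{t_0}^{t}A(\tau)\,d\tau\right\}dt=+\infty.$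 Then the system (S) is oscillatory.
   Context: Well-defined relations: for locally integrable functions $u,v$ on $[t_0,\infty)$, the relation $\frac{u(t)}{v(t)}$ is called well defined on $[t_0,\infty)$ if $v(t)\neq 0$ almost everywhere on $[t_0,\infty)$ and there exists a locally integrable function $\mu$ on $[t_0,\infty)$ with $u(t)=\mu(t)v(t)$ almost everywhere on $[t_0,\infty)$; in that case $\frac{u(t)}{v(t)}$ denotes $\mu(t)$, $t\ge t_0$. Notation (products such as $\frac{a_{1j}a_{j2}}{a_{12}}$ mean $\frac{a_{1j}}{a_{12}}\cdot a_{j2}$, where $\frac{a_{1j}}{a_{12}}$ denotes the absolutely continuous function $\mu_j$ on $[t_0,\infty)$ satisfying $a_{1j}(t)=\mu_j(t)a_{12}(t)$ almost everywhere on $[t_0,\infty)$): for $t\ge t_0$, $$A(t)= a_{11}(t)-a_{22}(t)-\sum_{j=3}^n\frac{a_{1j}(t)a_{j2}(t)}{a_{12}(t)},$$ $$B_k(t)= a_{22}(t)\frac{a_{1k}(t)}{a_{12}(t)}-a_{2k}(t)-\left(\frac{a_{1k}(t)}{a_{12}(t)}\right)'-\sum_{j=3}^n\left\{\frac{a_{1j}(t)}{a_{12}(t)}\left[a_{jk}(t)-a_{j2}(t)\right]+\frac{a_{1j}(t)a_{j2}(t)}{a_{12}(t)}\left[1-\frac{a_{1k}(t)}{a_{12}(t)}\right]\right\},\quad k=3,\dots,n,$$ $$C(t)=-a_{21}(t)-\sum_{j=3}^n\frac{a_{1j}(t)a_{j1}(t)}{a_{12}(t)}.$$ Solutions of the system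 are real-valued, locally absolutely continuous, and satisfy the equations almost everywhere. The system (S) is called oscillatory if for every solution $(\phi_1(t),\dots,\phi_n(t))$ the function $\phi_1(t)$ has arbitrarily large zeroes. The system (S) is called suboscillatory if for every solution $(\phi_1(t),\dots,\phi_n(t))$ at least one of the functions $\phi_1(t),\phi_3(t),\dots,\phi_n(t)$ has arbitrarily large zeroes. *)

(* Defs.v *)
From HB Require Import structures.
From mathcomp Require Import all_boot all_order all_algebra.
From mathcomp Require Import all_classical all_reals all_analysis.
Set Implicit Arguments.
Unset Strict Implicit.
Unset Printing Implicit Defensive.
Import Order.TTheory GRing.Theory Num.Theory.
Import numFieldNormedType.Exports.
Local Open Scope classical_set_scope.
Local Open Scope ring_scope.

(* The completed measure is used because [lebesgue_measure] only knows the
   Borel sets: with it, "integrable" would mean Borel measurable. *)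
Notation leb := completed_lebesgue_measure.

Section lebesgue_notions.
Context {R : realType}.
Implicit Types (D : set R) (P : R -> Prop) (f u v q : R -> R).

Definition ae_on D P : Prop := {ae (@leb R), forall t : R, D t -> P t}.

Definition loc_integrable (t0 : R) f : Prop :=
  forall T : R, t0 <= T -> (@leb R).-integrable `[t0, T] (EFin \o f).

Definition abs_continuous D f : Prop :=
  forall e : R, 0 < e -> exists2 d : R, 0 < d &
    forall (m : nat) (l r : 'I_m -> R),
      (forall i, l i <= r i) ->
      (forall i, `[l i, r i] `<=` D) ->
      trivIset [set: 'I_m] (fun i => [set` `]l i, r i[]) ->
      \sum_(i < m) (r i - l i) < d ->
      \sum_(i < m) `|f (r i) - f (l i)| < e.

Definition loc_abs_continuous (t0 : R) f : Prop :=
  forall T : R, t0 <= T -> abs_continuous `[t0, T] f.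

(* The relation u / v is well defined on [t0, +oo[ and q is its value. *)
Definition well_defined_relation (t0 : R) u v q : Prop :=
  [/\ ae_on `[t0, +oo[ (fun t => v t != 0),
      loc_integrable t0 q &
      ae_on `[t0, +oo[ (fun t => u t = q t * v t)].

Definition arbitrarily_large_zeroes (t0 : R) f : Prop :=
  forall T : R, t0 <= T -> exists2 t : R, T <= t & f t = 0.

End lebesgue_notions.

(* Indices are shifted by one: 1 and 2 become [idx1] and [idx2] (of values
   0 and 1), and the range 3, ..., n is the set of [j : 'I_n] with [2 <= j]. *)
Definition idx1 (n : nat) (hn : (3 <= n)%N) : 'I_n :=
  Ordinal (ltn_trans (isT : (0 < 2)%N) hn).
Definition idx2 (n : nat) (hn : (3 <= n)%N) : 'I_n :=
  Ordinal (ltn_trans (isT : (1 < 2)%N) hn).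

Section linear_system.
Context {R : realType} {n : nat}.
Variables (hn : (3 <= n)%N) (t0 : R) (a : 'I_n -> 'I_n -> R -> R).

Local Notation "1'" := (idx1 hn).
Local Notation "2'" := (idx2 hn).

Definition is_solution (phi : 'I_n -> R -> R) : Prop :=
  (forall j, loc_abs_continuous t0 (phi j)) /\
  (forall j, ae_on `[t0, +oo[
     (fun t : R => is_derive t (1 : R) (phi j) (\sum_(k < n) a j k t * phi k t))).

Definition oscillatory : Prop :=
  forall phi, is_solution phi -> arbitrarily_large_zeroes t0 (phi 1').

Definition suboscillatory : Prop :=
  forall phi, is_solution phi ->
    exists2 j : 'I_n, j != 2' & arbitrarily_large_zeroes t0 (phi j).

(* [q j] stands for a_{1j} / a_{12}; only the values at [2 <= j] are used. *)
Variable q : 'I_n -> R -> R.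

Definition funA (t : R) : R :=
  a 1' 1' t - a 2' 2' t - \sum_(j < n | (2 <= j)%N) q j t * a j 2' t.

(* The derivative of [q k] only makes sense almost everywhere; elsewhere
   [derive1] takes an irrelevant value. *)
Definition funB (k : 'I_n) (t : R) : R :=
  a 2' 2' t * q k t - a 2' k t - derive1 (q k) t
  - \sum_(j < n | (2 <= j)%N)
      (q j t * (a j k t - a j 2' t) + q j t * a j 2' t * (1 - q k t)).

Definition funC (t : R) : R :=
  - a 2' 1' t - \sum_(j < n | (2 <= j)%N) q j t * a j 1' t.

(* For t >= s: the two functions occurring under the integral signs, with the
   inner integral of A starting at s. *)
Definition weightP (s t : R) : R :=
  a 1' 2' t * expR (- \int[@leb R]_(tau in `[s, t]) funA tau).

Definition weightQ (s t : R) : R :=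
  funC t * expR (\int[@leb R]_(tau in `[s, t]) funA tau).

End linear_system.

(* Main.v *)
Require Import Defs.
From HB Require Import structures.
From mathcomp Require Import all_boot all_order all_algebra.
From mathcomp Require Import all_classical all_reals all_analysis.
From mathcomp Require Import measurable_realfun lra ring.

(** For a solution [phi] put [psi = phi_2 + sum_(j >= 3) (a_1j / a_12) phi_j]. Then
    [phi_1' = a_11 phi_1 + a_12 psi], and [w = psi / phi_1 * exp (int A)] satisfies,
    where [phi_1] does not vanish, the Riccati equation
    [w' = - P w^2 - Q - exp (int A) * sum_(k >= 3) B_k phi_k / phi_1]
    with [P = a_12 exp (- int A)] and [Q = C exp (int A)].

    If no [phi_j] with [j <> 2] has large zeroes, the signs of the [phi_k / phi_1]
    are eventually constant; on the interval [t1, t2] attached to these signs,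
    [w' <= - min (P, Q) (1 + w^2)], so [atan w] decreases there by at least [pi],
    which is impossible. If every [B_k] vanishes and [phi_1] has no large zero, then
    [w + int P w^2 + int Q] is constant; hence eventually [- w >= 1 + U] with
    [U = int P w^2], and [(1 / (1 + U))' <= - P] contradicts the divergence of the
    integral of [P].

    The calculus rests on the fact that an absolutely continuous function is the
    integral of its almost everywhere derivative: it is the difference of the
    nondecreasing functions [V] and [V - f], [V] being its total variation, and the
    Lebesgue-Stieltjes measures of both are absolutely continuous, so that the
    Radon-Nikodym and Lebesgue differentiation theorems apply. *)

Set Implicit Arguments.
Unset Strict Implicit.
Unset Printing Implicit Defensive.
Import Order.TTheory GRing.Theory Num.Theory.
Import numFieldNormedType.Exports.
Local Open Scope classical_set_scope.
Local Open Scope ring_scope.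

(** * Absolute continuity along ordered families of intervals *)

Section ordered_intervals.
Context {R : realType}.
Implicit Types (a b c d : R) (s : seq (R * R)) (f g h : R -> R).

(* [s] lists, from left to right, the endpoints of non-overlapping intervals
   of [a, b]. *)
Fixpoint ordered_itvs a b s : bool :=
  if s is x :: s' then [&& a <= x.1, x.1 <= x.2 & ordered_itvs x.2 b s']
  else a <= b.

Definition total_length s := \sum_(x <- s) (x.2 - x.1).

Definition increments f s := \sum_(x <- s) `|f x.2 - f x.1|.

Lemma ordered_itvs_le a b s : ordered_itvs a b s -> a <= b.
Proof.
elim: s a => //= x s IH a /and3P[ax xx /IH xb]; lra.
Qed.

Lemma ordered_itvs_cat a b c s t :
  ordered_itvs a b s -> ordered_itvs b c t -> ordered_itvs a c (s ++ t).
Proof.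
elim: s a => /= [a ab|x s IH a /and3P[-> -> /IH]//].
by case: t => /= [|x t /and3P[/(le_trans ab)-> -> ->]//]; exact: le_trans.
Qed.

Lemma ordered_itvsS a b c d s : c <= a -> b <= d ->
  ordered_itvs a b s -> ordered_itvs c d s.
Proof.
move=> ca bd os; rewrite -(cats0 s); apply: (@ordered_itvs_cat _ b) => //.
exact: (@ordered_itvs_cat _ a _ [::]).
Qed.

Lemma ordered_itvs_bounds a b s : ordered_itvs a b s ->
  forall x, x \in s -> [/\ a <= x.1, x.1 <= x.2 & x.2 <= b].
Proof.
elim: s a => //= y s IH a /and3P[ay yy os] x.
rewrite inE => /predU1P[->|/(IH _ os)[]]; last by split=> //; lra.
by split=> //; exact: ordered_itvs_le os.
Qed.

Lemma ordered_itvs_pairwise a b s : ordered_itvs a b s ->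
  pairwise (fun x y : R * R => x.2 <= y.1) s.
Proof.
elim: s a => //= y s IH a /and3P[ay yy os]; rewrite (IH _ os) andbT.
by apply/allP => z /(ordered_itvs_bounds os)[].
Qed.

Lemma increments_cat f s t : increments f (s ++ t) = increments f s + increments f t.
Proof. exact: big_cat. Qed.

(** Absolute continuity stated along sorted lists rather than indexed families: such lists can be
    concatenated and peeled from the left, which suits Cousin's lemma and induction. *)
Definition ordered_ac a b f := forall e : R, 0 < e -> exists2 d : R, 0 < d &
  forall s, ordered_itvs a b s -> total_length s < d -> increments f s < e.

Lemma abs_continuous_ordered a b f : abs_continuous `[a, b] f -> ordered_ac a b f.
Proof.
move=> acf e e0; have [d d0 fd] := acf e e0; exists d => // s os sd.
have := ordered_itvs_bounds os; have := ordered_itvs_pairwise os.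
move=> /(pairwiseP (0, 0)) ps bs.
have {}bs i (si : (i < size s)%N) := bs _ (mem_nth (0, 0) si).
rewrite /increments (big_nth (0, 0)) big_mkord.
apply: fd => [i|i x|i j _ _|].
- by have [] := bs _ (ltn_ord i).
- have [? ? ?] := bs _ (ltn_ord i).
  by rewrite /= !in_itv/= => /andP[? ?]; apply/andP; split; lra.
- move=> [x []]; rewrite /= !in_itv/= => /andP[? ?] /andP[? ?].
  have [ij|ji|/val_inj //] := ltngtP (val i) (val j).
  + by exfalso; have := ps _ _ (ltn_ord i) (ltn_ord j) ij; clear ij; lra.
  + by exfalso; have := ps _ _ (ltn_ord j) (ltn_ord i) ji; clear ji; lra.
- by move: sd; rewrite /total_length (big_nth (0, 0)) big_mkord.
Qed.

Lemma ordered_acS a b c d f : a <= c -> d <= b ->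
  ordered_ac a b f -> ordered_ac c d f.
Proof.
move=> ac db acf e e0; have [r r0 fr] := acf e e0; exists r => // s os.
by apply: fr; exact: ordered_itvsS os.
Qed.

Lemma ordered_ac_dist a b f : ordered_ac a b f -> forall e : R, 0 < e ->
  exists2 d : R, 0 < d & forall x y, a <= x <= b -> a <= y <= b ->
    `|x - y| < d -> `|f x - f y| < e.
Proof.
move=> acf e e0; have [d d0 fd] := acf e e0; exists d => //.
have H x y : a <= x <= b -> a <= y <= b -> x <= y ->
    `|x - y| < d -> `|f x - f y| < e.
  move=> /andP[ax xb] /andP[ay yb] xy; rewrite distrC ger0_norm ?subr_ge0// => xyd.
  have := fd [:: (x, y)]; rewrite /total_length /increments !big_seq1 distrC.
  by apply=> //=; rewrite ax xy.
move=> x y xab yab xyd; have [xy|/ltW yx] := leP x y; first exact: H.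
by rewrite distrC H// distrC.
Qed.

(** Common source of the closure properties: sums, products, inverses, exponentials and arctangents
    all have increments controlled in this way. *)
Lemma ordered_ac_lip2 a b f g h (K : R) : 0 <= K ->
  (forall x y, a <= x <= b -> a <= y <= b ->
    `|h x - h y| <= K * (`|f x - f y| + `|g x - g y|)) ->
  ordered_ac a b f -> ordered_ac a b g -> ordered_ac a b h.
Proof.
move=> K0 lip acf acg e e0.
(* The [+ 1] keeps the denominator positive when [K] is zero. *)
have e1 : 0 < e / (2 * (K + 1)) by apply: divr_gt0 => //; lra.
have [d1 d10 fd] := acf _ e1; have [d2 d20 gd] := acg _ e1.
exists (Num.min d1 d2); first by rewrite lt_min d10.
move=> s os; rewrite lt_min => /andP[/(fd s os) fs /(gd s os) gs].
apply: (@le_lt_trans _ _ (K * (increments f s + increments g s))).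
  rewrite /increments -big_split/= mulr_sumr big_seq [leRHS]big_seq.
  apply: ler_sum => x /(ordered_itvs_bounds os)[? ? ?].
  by apply: lip; apply/andP; split; lra.
apply: (@le_lt_trans _ _ (K * (e / (K + 1)))).
  apply: ler_wpM2l => //.
  have -> : e / (K + 1) = e / (2 * (K + 1)) + e / (2 * (K + 1)) by field; lra.
  by lra.
by rewrite mulrA ltr_pdivrMr; nra.
Qed.

Lemma ordered_ac_lip a b f h (K : R) : 0 <= K ->
  (forall x y, a <= x <= b -> a <= y <= b -> `|h x - h y| <= K * `|f x - f y|) ->
  ordered_ac a b f -> ordered_ac a b h.
Proof.
move=> K0 lip acf; apply: (@ordered_ac_lip2 _ _ f f _ K) => // x y xab yab.
by rewrite (le_trans (lip _ _ xab yab))// ler_wpM2l// lerDl.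
Qed.

(** Supremum argument on the points [x] with [P a x]. It turns a bound valid on all short intervals
    around each point into one on the whole of [a, b]. *)
Lemma cousin (P : R -> R -> Prop) a b : a <= b ->
  (forall x y z, x <= y -> y <= z -> P x y -> P y z -> P x z) ->
  (forall x, a <= x <= b -> exists2 d : R, 0 < d &
    forall l r, a <= l -> l <= x -> x <= r -> r <= b -> r - l < d -> P l r) ->
  P a b.
Proof.
move=> ab Ptrans Ploc.
pose S := [set x | a <= x <= b /\ P a x].
have Sa : S a.
  have [|d d0 Pd] := Ploc a; first by rewrite lexx.
  by split; [rewrite lexx|apply: Pd; rewrite // subrr].
have Sub : has_ubound S by exists b => x [/andP[]].
have hS : has_sup S by split; [exists a|].
set c := sup S.
have ac : a <= c by apply: ub_le_sup.
have cb : c <= b by apply: ge_sup; [exists a|move=> x [/andP[]]].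
have [|d d0 Pd] := Ploc c; first by rewrite ac.
have [x [/andP[ax xb] Pax] cx] := sup_adherent d0 hS; rewrite -/c in cx.
have xc : x <= c by apply: ub_le_sup => //; split; rewrite ?ax.
have key y : c <= y <= b -> y - x < d -> P a y.
  move=> /andP[cy yb] yxd; apply: (Ptrans a x y) => //; first exact: le_trans cy.
  exact: Pd.
(* A point beyond the supremum [c] by half of the slack left in [d], capped at [b]. It is still
   reachable from [x], so it cannot exceed [c], and the cap must be active. *)
pose y := Num.min b (c + (d - (c - x)) / 2).
have cy : c <= y by rewrite /y le_min cb/=; lra.
have yb : y <= b by rewrite /y ge_min lexx.
have yd : y <= c + (d - (c - x)) / 2 by rewrite /y ge_min lexx orbT.
have Py : P a y by apply: key; rewrite ?cy//; lra.
have yc : y <= c by apply: ub_le_sup => //; split=> //; rewrite yb (le_trans ac).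
suff : y = b by move=> <-.
by move: yc; rewrite /y; case: (leP b (c + (d - (c - x)) / 2)) => // _ h; exfalso; lra.
Qed.

End ordered_intervals.

(** * Total variation of an absolutely continuous function *)

Section total_variation_of_ac.
Context {R : realType}.
Implicit Types (a b l r : R) (f : R -> R).

Lemma total_length_le a b s : ordered_itvs a b s -> total_length s <= b - a.
Proof.
rewrite /total_length; elim: s a => /= [a ab|x s IH a /and3P[ax xx /IH h]].
  by rewrite big_nil subr_ge0.
by rewrite big_cons; lra.
Qed.

Lemma ordered_itvs_partition a b s :
  itv_partition a b s -> ordered_itvs a b (zip (a :: s) s).
Proof.
elim: s a => [a [_ /eqP/= ->]|x s IH a pas]; first exact: lexx.
have /IH h := itv_partition_cons pas.
by case: pas => /= /andP[/ltW ax _] _; rewrite /= lexx ax.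
Qed.

Lemma variation_increments a b f s : itv_partition a b s ->
  variation a b f s = increments f (zip (a :: s) s).
Proof.
move=> /variation_zip->; rewrite /increments.
elim: s a => [a|x s IH a]; first by rewrite !big_nil.
by rewrite /= !big_cons/= IH.
Qed.

(** On an interval shorter than the [d] attached to 1, the variation is at most 1. Finiteness is
    additive over adjacent intervals, so Cousin's lemma concludes. *)
Lemma ordered_ac_bounded_variation a b f : a <= b ->
  ordered_ac a b f -> bounded_variation a b f.
Proof.
move=> ab acf; apply/bounded_variationP => //.
rewrite ge0_fin_numE ?total_variation_ge0//.
have [d d0 fd] := acf _ ltr01.
apply: (@cousin R (fun l r => total_variation l r f < +oo)%E) => //.
  by move=> x y z xy yz xyoo yzoo; rewrite (total_variationD f xy yz) lte_add_pinfty.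
move=> x xab; exists d => // l r al lx xr rb rl.
apply: (@le_lt_trans _ _ 1%:E); last exact: ltry.
apply: ge_ereal_sup => _ [_ [s ps <-] <-].
rewrite lee_fin variation_increments// ltW// fd//.
  exact: ordered_itvsS (ordered_itvs_partition ps).
exact: le_lt_trans (total_length_le (ordered_itvs_partition ps)) rl.
Qed.

Lemma total_variation_approx l r f (e : R) : l <= r -> 0 < e ->
  bounded_variation l r f -> exists2 s, ordered_itvs l r s &
    fine (total_variation l r f) <= increments f s + e.
Proof.
move=> lr e0 /(bounded_variationP _ lr) bv.
have [_ [_ [s ps <-] <-]] := ub_ereal_sup_adherent e0 bv.
rewrite -/(total_variation l r f) -[X in (X - _)%E](fineK bv) lte_fin => h.
exists (zip (l :: s) s); first exact: ordered_itvs_partition.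
by rewrite -(variation_increments f ps); lra.
Qed.

End total_variation_of_ac.

(** * Projection of the line onto a segment *)

Section clamp.
Context {R : realType}.
Implicit Types (a b x y : R).

(** Composing with this projection extends a function from [a, b] to the whole line by constants,
    preserving continuity and monotonicity. *)
Definition clamp a b x := Num.max a (Num.min b x).

Lemma clampP a b x : a <= b -> a <= clamp a b x <= b.
Proof. by move=> ab; rewrite /clamp le_max lexx ge_max ab ge_min lexx. Qed.

Lemma clamp_id a b x : a <= x <= b -> clamp a b x = x.
Proof. by move=> /andP[ax xb]; rewrite /clamp (min_idPr xb) (max_idPr ax). Qed.

Lemma clamp_nondecreasing a b : {homo clamp a b : x y / x <= y}.
Proof. by move=> x y xy; rewrite /clamp; apply: le_max2 => //; exact: le_min2. Qed.

Lemma clamp_dist a b x y : a <= b -> `|clamp a b x - clamp a b y| <= `|x - y|.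
Proof.
move=> ab; have h1 := ler_norm (x - y); have := ler_norm (y - x).
rewrite distrC => h2; rewrite /clamp !maxElt !minElt ler_norml.
by repeat case: ifPn; rewrite -?leNgt; move=> *; apply/andP; split; lra.
Qed.

Lemma continuous_clamp a b (f : R -> R) : a <= b ->
  (forall e : R, 0 < e -> exists2 d : R, 0 < d & forall x y,
    a <= x <= b -> a <= y <= b -> `|x - y| < d -> `|f x - f y| < e) ->
  continuous (f \o clamp a b).
Proof.
move=> ab cf x; apply/cvgrPdist_lt => e e0; have [d d0 fd] := cf _ e0.
near=> y; apply: fd; rewrite ?clampP//; apply: le_lt_trans (clamp_dist _ _ ab) _.
by near: y; exact: cvgr_dist_lt.
Unshelve. all: by end_near. Qed.

End clamp.

(** * Absolutely continuous functions have densities *)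

Section dominated_increments.
Context {R : realType}.
Implicit Types (a b l r : R) (f G : R -> R).

(* The factor 2 makes the notion apply both to the total variation [V] of [f]
   and to [V \- f]. *)
Definition dominated_increments a b f G := forall l r e : R,
  a <= l -> l <= r -> r <= b -> 0 < e ->
  exists2 s, ordered_itvs l r s & G r - G l <= 2 * increments f s + e.

(** The half-open intervals are disjoint and contained in [U]; induction splits off the leftmost
    one. *)
Lemma total_length_le_measure a b s (U : set R) :
  measurable U -> ordered_itvs a b s ->
  (forall x, x \in s -> `[x.1, x.2] `<=` U) ->
  ((total_length s)%:E <= @lebesgue_measure R (U `&` `]a, b]))%E.
Proof.
move=> mU; rewrite /total_length; elim: s a => /= [a ab _|x s IH a].
  by rewrite big_nil measure_ge0.
move=> /and3P[ax xx os] sU; rewrite big_cons EFinD.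
have xb := ordered_itvs_le os.
have {}IH := IH _ os (fun y ys => sU y (mem_behead (s := x :: s) ys)).
apply: (@le_trans _ _ (lebesgue_measure (`]x.1, x.2] : set R) +
                       lebesgue_measure (U `&` `]x.2, b]))%E).
  apply: leeD => //; rewrite lebesgue_measure_itv/= lte_fin.
  case: ltP => // xx'; rewrite lee_fin; lra.
rewrite -measureU//=; last 2 first.
- exact: measurableI.
- apply/seteqP; split => // y [] /=; rewrite !in_itv/= => /andP[_ yx] [_].
  by rewrite ltNge yx.
apply: le_measure; rewrite ?inE/=.
- by apply: measurableU => //; exact: measurableI.
- exact: measurableI.
- move=> y [|[Uy]] /=; rewrite !in_itv/= => /andP[xy yx]; split => //.
  + by apply: (sU x); rewrite ?mem_head//= in_itv/= yx ltW.
  + by apply/andP; split; lra.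
  + by apply/andP; split; lra.
Qed.

Lemma lebesgue_stieltjes_itv (F : cumulative R R) l r : l <= r ->
  lebesgue_stieltjes_measure F `]l, r]%classic = (F r - F l)%:E.
Proof.
move=> lr; rewrite /lebesgue_stieltjes_measure /measure_extension.
by rewrite measurable_mu_extE/= ?wlength_itv_bnd//; exact: is_ocitv.
Qed.

(* The null set lies in an open set [U] of small measure, and [U] is exhausted
   by the sets [K n] at distance at least 1/(n+1) from its complement. On an
   interval of length less than 1/(n+1) either [K n] is empty or the interval
   lies in [U], so Cousin's lemma covers [K n] by ordered intervals of [U]. *)
Lemma lebesgue_stieltjes_null a b f (F : cumulative R R) (N : set R) : a <= b ->
  ordered_ac a b f -> dominated_increments a b f F ->
  measurable N -> @lebesgue_measure R N = 0%E ->
  lebesgue_stieltjes_measure F (N `&` `]a, b]) = 0%E.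
Proof.
move=> ab acf domF mN N0; set nu := lebesgue_stieltjes_measure F.
apply/eqP; rewrite eq_le measure_ge0 andbT; apply/lee_addgt0Pr => e e0.
(* Chosen so that the final bound [2 * e1 + e1 * (b - a)] is exactly [e]. *)
rewrite add0e; pose e1 := e / (2 + (b - a)).
have e10 : 0 < e1 by apply: divr_gt0 => //; lra.
have [d d0 fd] := acf _ e10.
have [|U [oU NU]] := @lebesgue_regularity_outer R N d mN _ d0.
  by rewrite [X in (X < _)%E]N0 ltry.
have mU : measurable U by exact: measurable_realfun.open_measurable.
move=> Ud; have {}Ud : (lebesgue_measure U < d%:E)%E.
  rewrite -(setDUK NU) measureU//=; last 2 first.
  - exact: measurableD.
  - by apply/seteqP; split => // x [Nx [_]].
  by rewrite [X in (X + _ < _)%E]N0 add0e.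
pose K n := [set x | forall y, `|x - y| < n.+1%:R^-1 -> U y].
have oK n : open (~` K n).
  have -> : ~` K n = \bigcup_(y in ~` U) ball y n.+1%:R^-1.
    apply/seteqP; split => x.
    - by move=> /existsNP[y /not_implyP[xy Uy]]; exists y => //=; rewrite /ball/= distrC.
    - by move=> [y Uy /=]; rewrite /ball/= distrC => xy /(_ _ xy).
  by apply: bigcup_open => y _; exact: ball_open.
have mK n : measurable (K n).
  by rewrite -(setCK (K n)); apply: measurableC; exact: measurable_realfun.open_measurable.
have mKitv n l r : measurable (K n `&` `]l, r]) by exact: measurableI.
have KU : U = \bigcup_n K n.
  apply/seteqP; split => [x Ux|x [n _ /(_ x)]]; last by rewrite subrr normr0; apply.
  have /nbhs_ballP[r /= r0 rU] := open_nbhs_nbhs (conj oU Ux).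
  have [n nr] : exists n, n.+1%:R^-1 < r.
    exists (Num.bound r^-1); rewrite -[ltRHS]invrK ltf_pV2 ?posrE ?invr_gt0//.
    by rewrite (lt_le_trans (archi_boundP _)) ?ler_nat// invr_ge0 ltW.
  by exists n => // y xy; apply: rU; rewrite /ball/= (lt_trans xy).
have bound n : (nu (K n `&` `]a, b]) <= e%:E)%E.
  have [s [os sU]] : exists s, [/\ ordered_itvs a b s,
      (forall x, x \in s -> `[x.1, x.2] `<=` U) &
      (nu (K n `&` `]a, b]) <= (2 * increments f s + e1 * (b - a))%:E)%E].
    apply: (@cousin R (fun l r => exists s, [/\ ordered_itvs l r s,
      (forall x, x \in s -> `[x.1, x.2] `<=` U) &
      (nu (K n `&` `]l, r]) <= (2 * increments f s + e1 * (r - l))%:E)%E])) => //.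
    - move=> x y z xy yz [s [os sU nus]] [t [ot tU nut]]; exists (s ++ t); split.
      + exact: ordered_itvs_cat os ot.
      + by move=> u; rewrite mem_cat => /orP[/sU|/tU].
      + have -> : K n `&` `]x, z] = (K n `&` `]x, y]) `|` (K n `&` `]y, z]).
          rewrite -setIUr; congr (_ `&` _).
          by rewrite -itv_bndbnd_setU//= bnd_simp.
        apply: le_trans; first by apply: measureU2; exact: mKitv.
        rewrite (le_trans (leeD nus nut))// -EFinD lee_fin increments_cat; lra.
    - move=> x xab; exists n.+1%:R^-1 => // l r al lx xr rb lrn.
      have [->|/set0P[y [Ky]]] := eqVneq (K n `&` `]l, r]) set0.
        exists [::]; split => //=; first exact: le_trans xr.
        rewrite [X in (X <= _)%E](measure0 (lebesgue_stieltjes_measure F)) lee_fin.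
        by rewrite /increments big_nil mulr0 add0r mulr_ge0 ?(ltW e10)//; lra.
      rewrite /= in_itv/= => /andP[ly yr].
      have lr : l < r by exact: lt_le_trans yr.
      have [||||s os Fs] := domF l r (e1 * (r - l)) => //; first exact: ltW.
        by rewrite mulr_gt0// subr_gt0.
      exists s; split => //.
        move=> u /(ordered_itvs_bounds os)[lu uu ur] v/=.
        rewrite in_itv/= => /andP[uv vu]; apply: Ky.
        by rewrite (le_lt_trans _ lrn)// ler_norml; apply/andP; split; lra.
      have Fnu : (nu `]l, r]%classic <= (2 * increments f s + e1 * (r - l))%:E)%E.
        by rewrite /nu lebesgue_stieltjes_itv ?lee_fin// ltW.
      apply: le_trans Fnu.
      by apply: le_measure; rewrite ?inE//=; exact: mKitv.
  move=> /le_trans; apply; rewrite lee_fin.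
  have h : increments f s < e1.
    apply: fd => //; rewrite -lte_fin; apply: le_lt_trans Ud.
    apply: le_trans (total_length_le_measure mU os sU) _.
    by apply: le_measure; rewrite ?inE//=; exact: measurableI.
  have -> : e = e1 * (2 + (b - a)) by rewrite /e1 divfK//; lra.
  lra.
(* The bound does not depend on [n], so continuity of the measure from below carries it from the
   sets [K n] to their union [U]. *)
apply: (@le_trans _ _ (nu (U `&` `]a, b]))).
  by apply: le_measure; rewrite ?inE//=; [exact: measurableI..|exact: setSI].
have mUab : measurable (U `&` `]a, b]) by exact: measurableI.
pose KK n := K n `&` `]a, b].
have KKU : \bigcup_n KK n = U `&` `]a, b] by rewrite KU setI_bigcupl.
have cvgU : nu (KK n) @[n --> \oo] --> nu (U `&` `]a, b]%classic).
  rewrite -KKU.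
  apply: (@nondecreasing_cvg_mu _ _ _ (lebesgue_stieltjes_measure F)) => //.
  - by move=> n; exact: mKitv.
  - by rewrite KKU; exact: mUab.
  - move=> m n mn; apply/subsetPset; apply: setSI => x Kx y xy; apply: Kx.
    by rewrite (lt_le_trans xy)// lef_pV2 ?posrE// ler_nat.
rewrite -(cvg_lim _ cvgU)//; apply: lime_le; last exact: nearW.
by apply/cvg_ex; exists (nu (U `&` `]a, b]%classic)).
Qed.

End dominated_increments.

(** * Radon-Nikodym densities *)

Section density_of_ac.
Context {R : realType}.
Implicit Types (a b l r : R) (f G : R -> R).
Notation mu := (@lebesgue_measure R).

Lemma dominated_increments_dist a b f G : ordered_ac a b f ->
  dominated_increments a b f G ->
  (forall x y, a <= x -> x <= y -> y <= b -> G x <= G y) ->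
  forall e : R, 0 < e -> exists2 d : R, 0 < d & forall x y,
    a <= x <= b -> a <= y <= b -> `|x - y| < d -> `|G x - G y| < e.
Proof.
move=> acf domG ndG e e0.
(* Domination counts the increments twice and adds an error: three contributions of at most
   [e / 3]. *)
have e30 : 0 < e / 3 by apply: divr_gt0.
have [d d0 fd] := acf _ e30; exists d => //.
have H x y : a <= x <= b -> a <= y <= b -> x <= y ->
    `|x - y| < d -> `|G x - G y| < e.
  move=> /andP[ax xb] /andP[ay yb] xy.
  rewrite distrC ger0_norm ?subr_ge0// => xyd.
  rewrite distrC ger0_norm ?subr_ge0 ?ndG//.
  have [s os Gs] := domG x y (e / 3) ax xy yb e30.
  have := fd s (ordered_itvsS ax yb os) (le_lt_trans (total_length_le os) xyd).
  lra.
move=> x y xab yab xyd; have [xy|/ltW yx] := leP x y; first exact: H.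
by rewrite distrC H// distrC.
Qed.

(** The Lebesgue-Stieltjes measure of the clamped [G], restricted to ]a, b], is finite and charges
    no null set. Evaluating its Radon-Nikodym density on ]a, x] gives the formula. *)
Lemma density_nondecreasing a b f G : a < b -> ordered_ac a b f ->
  dominated_increments a b f G ->
  (forall x y, a <= x -> x <= y -> y <= b -> G x <= G y) ->
  exists2 rho : R -> R, mu.-integrable [set: R] (EFin \o rho) &
    forall x, a <= x <= b -> G x - G a = \int[mu]_(t in `[a, x]) rho t.
Proof.
move=> ab acf domG ndG.
have ndF : {homo G \o clamp a b : x y / x <= y}.
  move=> x y xy /=; have /andP[ax _] := clampP x (ltW ab).
  by have /andP[_ yb] := clampP y (ltW ab); apply: ndG => //; exact: clamp_nondecreasing.
have rcF : right_continuous (G \o clamp a b).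
  apply: right_continuousW; apply: continuous_clamp (ltW ab) _.
  exact: dominated_increments_dist domG ndG.
pose F : cumulative R R := HB.pack (G \o clamp a b) (isCumulative.Build R _ R _ ndF rcF).
have FE x : a <= x <= b -> F x = G x by move=> xab; rewrite /= clamp_id.
have domF : dominated_increments a b f F.
  move=> l r e al lr rb e0; have [s os Gs] := domG l r e al lr rb e0; exists s => //.
  by rewrite !FE//; apply/andP; split; lra.
pose nu := lebesgue_stieltjes_measure F.
have mI : @measurable _ (measurableTypeR R) `]a, b]%classic by exact: measurable_itv.
have nuI : (nu `]a, b]%classic < +oo)%E.
  by rewrite /nu lebesgue_stieltjes_itv ?ltry// ltW.
pose nuI' : {finite_measure set (measurableTypeR R) -> \bar R} := mfrestr mI nuI.
have nu_mu : nuI' `<< mu.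
  apply/null_content_dominatesP => N mN N0.
  rewrite /nuI'/= /mfrestr /mrestr.
  exact: (lebesgue_stieltjes_null (ltW ab) acf domF mN N0).
have [g [g0 gfin ig gE]] := radon_nikodym_sigma_finite nu_mu.
have gfine : EFin \o (fine \o g) = g by apply/funext => x /=; rewrite fineK.
exists (fine \o g); first by rewrite gfine.
move=> x /andP[ax xb].
rewrite -Rintegral_itv_obnd_cbnd; last first.
  by rewrite gfine; exact: integrableS ig.
rewrite /Rintegral.
under eq_integral do rewrite -[(_ _)%:E]/((EFin \o (fine \o g)) _) gfine.
have mx : @measurable _ (measurableTypeR R) `]a, x]%classic by exact: measurable_itv.
rewrite -(gE _ mx) /nuI'/= /mfrestr /mrestr setIidl; last first.
  by apply: subset_itvl; rewrite bnd_simp.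
by rewrite [X in fine X]lebesgue_stieltjes_itv//= !clamp_id// ?lexx ?(ltW ab)// ax xb.
Qed.

Lemma ordered_ac_density a b f : a < b -> ordered_ac a b f ->
  exists2 rho : R -> R, mu.-integrable [set: R] (EFin \o rho) &
    forall x, a <= x <= b -> f x - f a = \int[mu]_(t in `[a, x]) rho t.
Proof.
move=> ab acf.
have bvf l r : a <= l -> l <= r -> r <= b -> bounded_variation l r f.
  by move=> al lr rb; apply: ordered_ac_bounded_variation => //; exact: ordered_acS acf.
(* The decomposition is [f = V - (V - f)], with both terms nondecreasing because the variation over
   an interval bounds the increment of [f]. *)
pose V x := fine (total_variation a x f).
have VB l r : a <= l -> l <= r -> r <= b -> V r - V l = fine (total_variation l r f).
  move=> al lr rb.
  have f1 : total_variation a l f \is a fin_num.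
    by apply/bounded_variationP => //; apply: bvf => //; exact: le_trans rb.
  have f2 : total_variation l r f \is a fin_num.
    by apply/bounded_variationP => //; exact: bvf.
  by rewrite /V (total_variationD f al lr) fineD// addrC addKr.
have fV l r : a <= l -> l <= r -> r <= b -> `|f r - f l| <= V r - V l.
  move=> al lr rb; rewrite VB// -lee_fin fineK ?total_variation_ge//.
  by apply/bounded_variationP => //; exact: bvf.
have [||g1 ig1 g1E] := @density_nondecreasing a b f V ab acf.
- move=> l r e al lr rb e0.
  have [s os Vs] := total_variation_approx lr e0 (bvf _ _ al lr rb).
  exists s => //; rewrite VB//; have : 0 <= increments f s by exact: sumr_ge0.
  by lra.
- move=> x y ax xy yb; have := fV _ _ ax xy yb; have := normr_ge0 (f y - f x); lra.
(* An increment of [V - f] is at most twice that of [V]; hence the variation is approximated up to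
   [e / 2]. *)
have [||g2 ig2 g2E] := @density_nondecreasing a b f (V \- f) ab acf.
- move=> l r e al lr rb e0.
  have e20 : 0 < e / 2 by apply: divr_gt0.
  have [s os Vs] := total_variation_approx lr e20 (bvf _ _ al lr rb).
  exists s => //=; have := VB _ _ al lr rb; have := fV _ _ al lr rb.
  by rewrite ler_norml => /andP[]; lra.
- move=> x y ax xy yb /=; have := fV _ _ ax xy yb.
  by rewrite ler_norml => /andP[]; lra.
exists (g1 \- g2).
  have -> : EFin \o (g1 \- g2) = ((EFin \o g1) \- (EFin \o g2))%E by [].
  exact: integrableB.
move=> x xab; rewrite RintegralB//; last 2 first.
- exact: integrableS ig1.
- exact: integrableS ig2.
by rewrite -g1E// -g2E//=; lra.
Qed.

End density_of_ac.

(** * Calculus with the completed Lebesgue measure *)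

Section completed_lebesgue.
Context {R : realType}.
Implicit Types (D E : set R) (f h : R -> R).
Notation mu := (@lebesgue_measure R).
Notation lT := (caratheodory_type (wlength (@idfun R))^*%mu).

Lemma measurable_completed D : measurable D -> @measurable _ lT D.
Proof. exact: sub_caratheodory. Qed.

Lemma negligible_completed (N : set R) : mu.-negligible N -> (@leb R).-negligible N.
Proof. by move=> [A [mA A0 NA]]; exists A; split => //; exact: measurable_completed. Qed.

Lemma ae_completed (P : R -> Prop) : {ae mu, forall x, P x} -> {ae (@leb R), forall x, P x}.
Proof. exact: negligible_completed. Qed.

Lemma measurable_fun_completed d (T : measurableType d) D (h : R -> T) :
  measurable D -> measurable_fun D h -> measurable_fun (D : set lT) h.
Proof. by move=> mD mh _ Y mY; apply: measurable_completed; exact: mh. Qed.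

(** The identity pushes the completed measure forward to the Borel one, which settles nonnegative
    functions; positive and negative parts give the general case. *)
Lemma integral_completed D (h : R -> \bar R) : measurable D -> measurable_fun D h ->
  (\int[@leb R]_(x in D) h x = \int[mu]_(x in D) h x)%E.
Proof.
move=> mD mh.
have mid : measurable_fun [set: lT] (idfun : lT -> measurableTypeR R).
  by move=> _ Y mY; rewrite setTI; exact: measurable_completed.
have int_ge0 (g : R -> \bar R) : measurable_fun D g -> (forall x, 0 <= g x)%E ->
    (\int[@leb R]_(x in D) g x = \int[mu]_(x in D) g x)%E.
  move=> mg g0.
  by rewrite -(@ge0_integral_pushforward _ _ lT (measurableTypeR R) R idfun mid
    (@leb R) D g)//.
rewrite integralE [RHS]integralE !int_ge0//.
- exact: measurable_funeneg.
- exact: measurable_funepos.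
Qed.

Lemma integrable_completed D (h : R -> \bar R) : measurable D ->
  mu.-integrable D h -> (@leb R).-integrable D h.
Proof.
move=> mD /integrableP[mh hoo]; apply/integrableP; split.
  exact: measurable_fun_completed.
by rewrite integral_completed//; exact: measurableT_comp.
Qed.

(* The superlevel sets of [f] at a countable dense set of values are Borel up to
   null sets; removing all of these null sets at once makes [f] Borel. *)
Lemma completed_measurable_borel D f : measurable D ->
  measurable_fun (D : set lT) f ->
  exists2 h : R -> R, measurable_fun setT h &
    {ae (@leb R), forall x, D x -> f x = h x}.
Proof.
move=> mD mf.
(* An enumeration of the rationals; indices that decode to nothing give 0. *)
pose r n : R := ratr (odflt 0 (unpickle n)).
(* A set of the completed algebra is a Borel set [X] together with a part of a Borel null set [M],
   so the two agree outside [M]. *)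
have cA n : exists X M : set R, [/\ measurable X, measurable M, mu M = 0%E &
    D `&` f @^-1` `]r n, +oo[ `\` M = X `\` M].
  have mA : @measurable _ lT (D `&` f @^-1` `]r n, +oo[).
    by apply: mf; [exact: measurable_completed|exact: measurable_itv].
  have : completed_algebra_gen mu (D `&` f @^-1` `]r n, +oo[).
    rewrite -g_sigma_completed_algebra_genE completed_caratheodory_measurable.
    exact: mA.
  move=> -[X mX [N [M [mM M0 NM]] <-]].
  exists X, M; split => //.
  by rewrite setDUl (_ : N `\` M = set0) ?setU0//; apply/seteqP; split => // x [/NM].
have /choice[X /choice[M XM]] := cA.
have [B [mB B0 MB]] : mu.-negligible (\bigcup_n M n).
  apply: negligible_bigcup => n; have [_ mM M0 _] := XM n; exists (M n).
  by split; [exact: mM|exact: M0|].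
have mDB : measurable (D `\` B) by exact: measurableD.
exists (f \_ (D `\` B)).
  apply/(measurable_restrictT _ mDB).
  apply: (@measurability _ _ R R _ f (@RGenOInfty.G R) (RGenOInfty.measurableE R)).
  move=> _ [_ [y ->] <-].
  (* A superlevel set at a real [y] is the union of those at the rationals above [y], each Borel
     once [B] is removed. *)
  have -> : (D `\` B) `&` f @^-1` `]y, +oo[ =
      \bigcup_(n in [set n | y < r n]) (X n `\` B).
    have XB n : X n `\` B = (D `\` B) `&` f @^-1` `]r n, +oo[.
      have [_ _ _ E] := XM n.
      have MnB : M n `|` B = B.
        by apply/setUidPr; apply: subset_trans MB; exact: bigcup_sup.
      rewrite (_ : X n `\` B = (X n `\` M n) `\` B); last first.
        by rewrite setDDl MnB.
      by rewrite -E setDDl MnB; apply/seteqP; split => z [[]].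
    apply/seteqP; split => x.
    - move=> [DBx]; rewrite /= in_itv/= andbT => yfx.
      have [q qy] := rat_in_itvoo yfx; exists (pickle q).
        by rewrite /= /r pickleK/= (itvP qy).
      by rewrite XB; split => //=; rewrite in_itv/= /r pickleK/= (itvP qy).
    - move=> [n yn XBx]; have : (X n `\` B) x by [].
      rewrite XB => -[DBx]; rewrite /= !in_itv/= !andbT => nx; split => //.
      exact: lt_trans nx.
  by apply: bigcup_measurable => n _; have [? _ _ _] := XM n; exact: measurableD.
have nB : mu.-negligible B by exists B; split.
apply: negligibleS (negligible_completed nB) => x /=.
apply: contra_notP => Bx Dx; rewrite patchE mem_set//.
Qed.

End completed_lebesgue.

(** * Integrals and almost everywhere derivatives of absolutely continuous functions *)

Section calculus_of_ac.
Context {R : realType}.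
Implicit Types (a b c x y : R) (D E : set R) (f g h : R -> R).
Notation mu := (@lebesgue_measure R).
Notation lT := (caratheodory_type (wlength (@idfun R))^*%mu).

Lemma ae_onS D (P Q : R -> Prop) : (forall x, D x -> P x -> Q x) ->
  ae_on D P -> ae_on D Q.
Proof.
move=> PQ; apply: (@filterS _ _ (ae_filter_ringOfSetsType (@leb R))).
by move=> x Px Dx; exact: PQ (Px Dx).
Qed.

Lemma ae_onS2 D (P Q S : R -> Prop) : (forall x, D x -> P x -> Q x -> S x) ->
  ae_on D P -> ae_on D Q -> ae_on D S.
Proof.
move=> PQS; apply: (@filterS2 _ _ (ae_filter_ringOfSetsType (@leb R))).
by move=> x Px Qx Dx; exact: PQS (Px Dx) (Qx Dx).
Qed.

Lemma ae_on_subset D E (P : R -> Prop) : E `<=` D -> ae_on D P -> ae_on E P.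
Proof. move=> ED; apply: (@filterS _ _ (ae_filter_ringOfSetsType (@leb R))) => x Px.
by move=> /ED; exact: Px. Qed.

Lemma ordered_ac_bounded a b f : a <= b -> ordered_ac a b f ->
  exists M : R, forall x, a <= x <= b -> `|f x| <= M.
Proof.
move=> ab acf.
have bv : total_variation a b f \is a fin_num.
  by apply/bounded_variationP => //; exact: ordered_ac_bounded_variation.
exists (`|f a| + fine (total_variation a b f)) => x /andP[ax xb].
rewrite -[f x](subrKC (f a)) (le_trans (ler_normD _ _))// lerD2l -lee_fin fineK//.
apply: le_trans (total_variation_ge f ax) _.
by rewrite (total_variationD f ax xb) leeDl// total_variation_ge0.
Qed.

Lemma ordered_ac_measurable a b f : a <= b -> ordered_ac a b f ->
  measurable_fun (`[a, b] : set lT) f.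
Proof.
move=> ab acf; apply: measurable_fun_completed; first exact: measurable_itv.
have cf := continuous_clamp ab (ordered_ac_dist acf).
apply: (@eq_measurable_fun _ _ _ _ _ (f \o clamp a b)).
  by move=> x /[!inE]/= /[!in_itv]/= xab; rewrite clamp_id.
by apply: measurable_funTS; exact: continuous_measurable_fun.
Qed.

Lemma measurable_itv_completed a b : @measurable _ lT `[a, b]%classic.
Proof. by apply: measurable_completed; exact: measurable_itv. Qed.

Lemma integrable_mul_ac a b f g : a <= b -> (@leb R).-integrable `[a, b] (EFin \o f) ->
  ordered_ac a b g -> (@leb R).-integrable `[a, b] (EFin \o (fun x => f x * g x)).
Proof.
move=> ab intf acg; have [M gM] := ordered_ac_bounded ab acg.
have -> : EFin \o (fun x => f x * g x) = ((EFin \o f) \* (EFin \o g))%E.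
  by apply/funext => x /=; rewrite EFinM.
apply: integrableMl => //; first exact: measurable_itv_completed.
  exact: ordered_ac_measurable.
exists M; split; first exact: num_real.
move=> N MN x; rewrite /= in_itv/= => xab; exact: le_trans (gM _ xab) (ltW MN).
Qed.

(** Completeness of the measure is what makes [g] measurable. *)
Lemma ae_eq_integrable a b f g : (@leb R).-integrable `[a, b] (EFin \o f) ->
  ae_on `[a, b] (fun x => f x = g x) ->
  (@leb R).-integrable `[a, b] (EFin \o g) /\
  \int[@leb R]_(x in `[a, b]) f x = \int[@leb R]_(x in `[a, b]) g x.
Proof.
move=> intf fg; have /integrableP[mf foo] := intf.
have mab := measurable_itv_completed a b.
have fg' : ae_eq (@leb R) `[a, b]%classic (EFin \o f) (EFin \o g).
  by apply: ae_onS fg => x _ /= ->.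
have mg := ae_measurable_fun completed_lebesgue_measure_is_complete fg' mf.
split; last by congr fine; exact: (@ae_eq_integral _ lT R (@leb R)).
apply/integrableP; split; first exact: mg.
suff <- : (\int[@leb R]_(x in `[a, b]) `|(EFin \o f) x| =
           \int[@leb R]_(x in `[a, b]) `|(EFin \o g) x|)%E by exact: foo.
apply: (@ae_eq_integral _ lT R (@leb R)).
- exact: mab.
- exact: measurableT_comp mf.
- exact: measurableT_comp mg.
- by apply: ae_onS fg => x _ /= ->.
Qed.

Lemma integrableS_itv a b c d f : a <= c -> d <= b ->
  (@leb R).-integrable `[a, b] (EFin \o f) -> (@leb R).-integrable `[c, d] (EFin \o f).
Proof.
move=> ac db; apply: integrableS; [exact: measurable_itv_completed..|].
by apply: subset_itv; rewrite bnd_simp.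
Qed.

(** Reduces integrals for the completed measure to Borel ones; [h] is set to zero outside [a, b] to
    be integrable on the whole line. *)
Lemma borel_density a b f : (@leb R).-integrable `[a, b] (EFin \o f) ->
  exists h, [/\ mu.-integrable [set: R] (EFin \o h),
    ae_on `[a, b] (fun x => f x = h x) &
    forall x y, a <= x -> y <= b ->
      \int[@leb R]_(t in `[x, y]) f t = \int[mu]_(t in `[x, y]) h t].
Proof.
move=> intf; have mab : measurable (`[a, b] : set R) by exact: measurable_itv.
have [h mh fh] : exists2 h : R -> R, measurable_fun setT h &
    ae_on `[a, b] (fun x => f x = h x).
  apply: completed_measurable_borel => //.
  by apply/measurable_EFinP; exact: measurable_int intf.
have [inth _] := ae_eq_integrable intf fh.
have inthB : mu.-integrable `[a, b] (EFin \o h).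
  apply/integrableP; split; first by apply/measurable_EFinP; exact: measurable_funTS.
  move/integrableP : inth => [_]; rewrite integral_completed//.
  by apply: measurableT_comp => //; apply/measurable_EFinP; exact: measurable_funTS.
exists (h \_ `[a, b]); split.
- rewrite -restrict_EFin.
  by apply: (@integrable_mkcond _ (measurableTypeR R) R mu _ (EFin \o h) _).1.
- by apply: ae_onS fh => x xab ->; rewrite patchE mem_set.
- move=> x y ax yb; have [intf' fhE] : (@leb R).-integrable `[x, y] (EFin \o h) /\
      \int[@leb R]_(t in `[x, y]) f t = \int[@leb R]_(t in `[x, y]) h t.
    apply: ae_eq_integrable; first exact: integrableS_itv intf.
    by apply: ae_on_subset fh; apply: subset_itv; rewrite bnd_simp.
  rewrite fhE /Rintegral integral_completed//; last first.
    by apply/measurable_EFinP; exact: measurable_funTS.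
  congr fine; apply: eq_integral => t /[!inE] txy; rewrite patchE mem_set//.
  by apply: subset_itv txy; rewrite bnd_simp.
Qed.

(** The integral of [|h|] is small on every set of small measure; this is applied to the union of
    the half-open intervals of the list. *)
Lemma ordered_ac_integral a b h : mu.-integrable [set: R] (EFin \o h) ->
  ordered_ac a b (fun x => \int[mu]_(t in `[a, x]) h t).
Proof.
move=> inth e e0; have [d [d0 hd]] := integral_normr_continuous inth e0.
have inthA (A : set R) : measurable A -> mu.-integrable A (EFin \o h).
  by move=> mA; exact: integrableS inth.
have intnA (A : set R) : measurable A -> mu.-integrable A (EFin \o (fun x => `|h x|)).
  by move=> mA; exact: integrable_abse (inthA _ mA).
exists d => // s os sd.
pose S (s : seq (R * R)) : set R := \big[setU/set0]_(x <- s) `]x.1, x.2]%classic.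
have mS t : measurable (S t).
  by rewrite /S; elim: t => [|x t IH]; rewrite ?big_nil// big_cons; exact: measurableU.
have Sitv c t : ordered_itvs c b t -> S t `<=` `]c, b].
  elim: t c => [c _|x t IH c /= /and3P[cx xx ot]]; first by rewrite /S big_nil.
  rewrite /S big_cons -/(S t) => z [|/(IH _ ot)]; rewrite /= !in_itv/= => /andP[h1 h2].
    by rewrite (le_lt_trans cx)//= (le_trans h2)// (ordered_itvs_le ot).
  by rewrite h2 andbT (le_lt_trans cx)// (le_lt_trans xx).
(* Induction on the list with a free left endpoint [c]: measure and integral are additive over the
   first interval and the remaining ones. *)
have key c t : a <= c -> ordered_itvs c b t -> mu (S t) = (total_length t)%:E /\
    increments (fun x => \int[mu]_(t in `[a, x]) h t) t <= \int[mu]_(x in S t) `|h x|.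
  elim: t c => [c _ _|x t IH c ac /= /and3P[cx xx ot]].
    by rewrite /S /total_length /increments !big_nil measure0 Rintegral_set0.
  have {IH}[|IH1 IH2] := IH x.2 _ ot; first lra.
  have St : S (x :: t) = `]x.1, x.2]%classic `|` S t by rewrite /S big_cons.
  have dis : `]x.1, x.2]%classic `&` S t = set0.
    apply/seteqP; split => // z [] /= /[swap] /(Sitv _ _ ot).
    by rewrite /= !in_itv/= => /andP[h1 _] /andP[_ h2]; move: h1; rewrite ltNge h2.
  rewrite St /total_length /increments !big_cons; split.
    rewrite measureU//=; last exact: mS.
    rewrite EFinD -IH1 lebesgue_measure_itv/= lte_fin; congr (_ + _)%E.
    by case: ltP => // x21; congr (_%:E); lra.
  rewrite Rintegral_setU//; last 3 first.
  - exact: mS.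
  - exact: (intnA _ (measurableU _ _ (measurable_itv _) (mS t))).
  - exact/disj_set2P.
  apply: lerD => //.
  have intx (i : interval R) : mu.-integrable [set` i] (EFin \o h).
    exact: (inthA _ (measurable_itv i)).
  rewrite (Rintegral_itvB (intx _)) ?bnd_simp//; last lra.
  by apply: le_normr_Rintegral; [exact: (measurable_itv `]x.1, x.2])|exact: intx].
have [SL SI] := key a s (lexx _) os.
apply: le_lt_trans SI (hd _ (mS s) _).
by move: sd; rewrite -lte_fin -SL.
Qed.

Lemma ae_neq c : {ae (@leb R), forall x : R, x != c}.
Proof.
apply: ae_completed; exists [set c]; split.
- exact: measurable_set1.
- exact: lebesgue_measure_set1.
- by move=> x /= /negP; rewrite negbK => /eqP.
Qed.

Lemma ae_is_derive_integral a b h f : mu.-integrable [set: R] (EFin \o h) ->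
  (forall x, a <= x <= b -> f x - f a = \int[mu]_(t in `[a, x]) h t) ->
  ae_on `[a, b] (fun x => is_derive x (1 : R) f (h x)).
Proof.
move=> inth fE.
have intI y : mu.-integrable [set` Interval (BLeft a) (BRight y)] (EFin \o h).
  by exact: integrableS inth.
have /ae_completed hd := FTC1 intI (open_integrable_locally openT inth).
(* The endpoints form a null set; at any other point [f] agrees with the indefinite integral on a
   neighbourhood, so Lebesgue differentiation applies to it. *)
apply: (@filterS3 _ _ (ae_filter_ringOfSetsType (@leb R))) hd (ae_neq a) (ae_neq b).
move=> x hx xa xb.
rewrite /= in_itv/= => /andP[ax bx].
have {}ax : a < x by rewrite lt_neqAle eq_sym xa.
have {}bx : x < b by rewrite lt_neqAle xb.
have [|dF dFE] := hx; first by rewrite lte_fin.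
have : is_derive x (1 : R) (fun x => f a + \int[mu]_(t in `[a, x]) h t) (h x).
  rewrite -[h x]add0r -dFE derive1E; apply: is_deriveD.
  exact: DeriveDef.
have /near_in_itvoo xI : x \in `]a, b[ by rewrite in_itv/= ax.
apply: near_eq_is_derive; near=> z.
have zab : a <= z <= b.
  have : z \in `]a, b[ by near: z.
  by rewrite in_itv/= => /andP[/ltW-> /ltW->].
by rewrite -(fE z zab) addrC subrK.
Unshelve. all: by end_near. Qed.

Lemma ordered_ac_integral_completed a b f : (@leb R).-integrable `[a, b] (EFin \o f) ->
  let J x := \int[@leb R]_(t in `[a, x]) f t in
  ordered_ac a b J /\ ae_on `[a, b] (fun x => is_derive x (1 : R) J (f x)).
Proof.
move=> /borel_density[h [inth fh fhE]] J.
have JE x : a <= x <= b -> J x = \int[mu]_(t in `[a, x]) h t.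
  by move=> /andP[ax xb]; rewrite -fhE.
split.
  apply: (@ordered_ac_lip _ a b _ J 1 ler01 _ (ordered_ac_integral a b inth)) => x y xab yab.
  by rewrite !JE// mul1r.
have : ae_on `[a, b] (fun x => is_derive x (1 : R) J (h x)).
  apply: ae_is_derive_integral inth _ => x /andP[ax xb].
  rewrite !JE ?lexx ?ax ?(le_trans ax xb)//.
  by rewrite set_itv1 Rintegral_set1 subr0.
by apply: ae_onS2 fh => x _ ->.
Qed.

(** The density of [f] is also its derivative almost everywhere, so the fundamental theorem of
    calculus holds for the completed measure. *)
Lemma ordered_ac_ftc a b f : a < b -> ordered_ac a b f -> exists rho,
  [/\ (@leb R).-integrable `[a, b] (EFin \o rho),
    ae_on `[a, b] (fun x => is_derive x (1 : R) f (rho x)) &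
    f b - f a = \int[@leb R]_(t in `[a, b]) rho t].
Proof.
move=> ab acf; have [rho intr rhoE] := ordered_ac_density ab acf.
have intab : mu.-integrable `[a, b] (EFin \o rho) by exact: integrableS intr.
exists rho; split.
- by apply: integrable_completed => //; exact: measurable_itv.
- exact: ae_is_derive_integral.
- rewrite rhoE ?lexx ?(ltW ab)// /Rintegral integral_completed//.
  by have /integrableP[mrho _] := intab; exact: mrho.
Qed.

Lemma ordered_ac_le_integral a b f g : a < b -> ordered_ac a b f ->
  (@leb R).-integrable `[a, b] (EFin \o g) ->
  ae_on `[a, b] (fun x => exists2 d : R, is_derive x (1 : R) f d & d <= g x) ->
  f b - f a <= \int[@leb R]_(t in `[a, b]) g t.
Proof.
move=> ab acf intg fg; have [rho [intr fr ->]] := ordered_ac_ftc ab acf.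
(* The bound on the derivative holds only almost everywhere; replacing [g] by [rho \max g] leaves
   the integral unchanged and makes the comparison hold everywhere. *)
have [intm ->] : (@leb R).-integrable `[a, b] (EFin \o (rho \max g)) /\
    \int[@leb R]_(x in `[a, b]) g x = \int[@leb R]_(x in `[a, b]) (rho \max g) x.
  apply: ae_eq_integrable => //; apply: ae_onS2 fr fg => x _ fr [d fd dg].
  have rd : rho x = d.
    by rewrite -(@derive_val _ _ _ _ _ _ _ fd) (@derive_val _ _ _ _ _ _ _ fr).
  by rewrite /= rd; exact/esym/max_idPr.
apply: le_Rintegral => //; first exact: measurable_itv_completed.
by move=> x _ /=; rewrite le_max lexx.
Qed.

Lemma ordered_ac_eq_integral a b f g : a < b -> ordered_ac a b f ->
  (@leb R).-integrable `[a, b] (EFin \o g) ->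
  ae_on `[a, b] (fun x => is_derive x (1 : R) f (g x)) ->
  f b - f a = \int[@leb R]_(t in `[a, b]) g t.
Proof.
move=> ab acf intg fg; have [rho [intr fr ->]] := ordered_ac_ftc ab acf.
have [] // := @ae_eq_integrable a b rho g intr.
apply: ae_onS2 fr fg => x _ fr fg.
by rewrite -(@derive_val _ _ _ _ _ _ _ fr) (@derive_val _ _ _ _ _ _ _ fg).
Qed.

End calculus_of_ac.

(** * Closure properties of absolute continuity, integrability and derivation *)

Section closure_properties.
Context {R : realType}.
Implicit Types (a b x y : R) (f g : R -> R).

Lemma ordered_ac_cst a b (k : R) : ordered_ac a b (fun=> k).
Proof.
move=> e e0; exists 1 => // s _ _; rewrite /increments big1// => x _.
by rewrite subrr normr0.
Qed.

Lemma ordered_acD a b f g : ordered_ac a b f -> ordered_ac a b g ->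
  ordered_ac a b (fun x => f x + g x).
Proof.
apply: (ordered_ac_lip2 ler01) => x y _ _; rewrite mul1r opprD addrACA.
exact: ler_normD.
Qed.

Lemma ordered_ac_sum a b (I : Type) (r : seq I) (P : pred I) (f : I -> R -> R) :
  (forall i, P i -> ordered_ac a b (f i)) ->
  ordered_ac a b (fun x => \sum_(i <- r | P i) f i x).
Proof.
move=> acf; elim: r => [|i r IH].
  under eq_fun do rewrite big_nil.
  exact: ordered_ac_cst.
under eq_fun do rewrite big_cons.
case: (boolP (P i)) => //= Pi.
by apply: ordered_acD => //; exact: acf.
Qed.

Lemma ordered_acM a b f g : a <= b -> ordered_ac a b f -> ordered_ac a b g ->
  ordered_ac a b (fun x => f x * g x).
Proof.
move=> ab acf acg; have [M fM] := ordered_ac_bounded ab acf.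
have [N gN] := ordered_ac_bounded ab acg.
have aab : a <= a <= b by rewrite lexx.
have M0 : 0 <= M by exact: le_trans (normr_ge0 _) (fM a aab).
have N0 : 0 <= N by exact: le_trans (normr_ge0 _) (gN a aab).
apply: (ordered_ac_lip2 (addr_ge0 M0 N0) _ acf acg) => x y xab yab.
have -> : f x * g x - f y * g y = f x * (g x - g y) + g y * (f x - f y) by ring.
rewrite (le_trans (ler_normD _ _))// !normrM.
have h1 : `|f x| * `|g x - g y| <= M * `|g x - g y| by apply: ler_wpM2r => //; exact: fM.
have h2 : `|g y| * `|f x - f y| <= N * `|f x - f y| by apply: ler_wpM2r => //; exact: gN.
have h3 : 0 <= M * `|f x - f y| by exact: mulr_ge0.
have h4 : 0 <= N * `|g x - g y| by exact: mulr_ge0.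
by lra.
Qed.

Lemma ordered_ac_continuous_clamp a b f : a <= b -> ordered_ac a b f ->
  continuous (f \o clamp a b).
Proof. by move=> ab acf; apply: continuous_clamp => //; exact: ordered_ac_dist. Qed.

(** By compactness [|f|] has a positive minimum [m], and inversion is Lipschitz with constant
    [m ^- 2] away from ]-m, m[. *)
Lemma ordered_acV a b f : a <= b -> ordered_ac a b f ->
  (forall x, a <= x <= b -> f x != 0) -> ordered_ac a b (fun x => (f x)^-1).
Proof.
move=> ab acf f0.
have [|c] := @EVT_min R (fun x => `|(f \o clamp a b) x|) a b ab.
  apply: continuous_subspaceT => x; apply: cvg_norm.
  exact: ordered_ac_continuous_clamp.
rewrite in_itv/= => cab fc; set m := `|f c|.
have m0 : 0 < m by rewrite normr_gt0 f0.
have {}fc x : a <= x <= b -> m <= `|f x|.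
  by move=> xab; have := fc x; rewrite in_itv/= !clamp_id//; exact.
apply: (@ordered_ac_lip _ a b f _ (m ^- 2) _ _ acf).
  by rewrite invr_ge0 exprn_ge0// ltW.
move=> x y xab yab.
have -> : (f x)^-1 - (f y)^-1 = (f x)^-1 * (f y)^-1 * (f y - f x).
  by field; rewrite !f0.
rewrite !normrM !normfV distrC ler_wpM2r// expr2 invfM.
by apply: ler_pM; rewrite ?invr_ge0// lef_pV2 ?posrE ?normr_gt0 ?f0// fc.
Qed.

(** The exponential is Lipschitz with constant [expR M] below [M], because
    [1 - expR (v - u) <= u - v]. *)
Lemma ordered_ac_expR a b f : a <= b -> ordered_ac a b f ->
  ordered_ac a b (fun x => expR (f x)).
Proof.
move=> ab acf; have [M fM] := ordered_ac_bounded ab acf.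
apply: (@ordered_ac_lip _ a b f _ (expR M) _ _ acf); first exact: expR_ge0.
have H (u v : R) : `|u| <= M -> v <= u -> `|expR u - expR v| <= expR M * `|u - v|.
  move=> uM vu; rewrite !ger0_norm ?subr_ge0 ?ler_expR//.
  have -> : expR u - expR v = expR u * (1 - expR (v - u)).
    by rewrite mulrBr mulr1 -expRD subrKC.
  have := expR_ge1Dx (v - u) => h.
  apply: ler_pM; rewrite ?expR_ge0 ?ler_expR ?(le_trans (ler_norm u))//.
    by rewrite subr_ge0 expR_le1 subr_le0.
  by lra.
move=> x y xab yab; have [xy|/ltW yx] := leP (f x) (f y).
  by rewrite distrC (distrC (f x)); apply: H => //; exact: fM.
by apply: H => //; exact: fM.
Qed.

(** By the mean value theorem the arctangent is 1-Lipschitz, its derivative being at most 1. *)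
Lemma ordered_ac_atan a b f : ordered_ac a b f -> ordered_ac a b (atan \o f).
Proof.
move=> acf; apply: (ordered_ac_lip ler01 _ acf) => x y _ _ /=; rewrite mul1r.
have H (u v : R) : u <= v -> `|atan v - atan u| <= `|v - u|.
  move=> uv; have [|c _ ->] := @MVT_segment R atan (fun x => (1 + x ^+ 2)^-1) u v uv _.
    by apply: continuous_subspaceT; exact: continuous_atan.
  rewrite normrM ler_piMl// ger0_norm ?invr_ge0 ?addr_ge0 ?sqr_ge0//.
  by rewrite invf_le1 ?lerDl ?sqr_ge0// ltr_wpDr ?sqr_ge0.
have [xy|/ltW yx] := leP (f x) (f y); last exact: H.
by rewrite distrC (distrC (f x)) H.
Qed.

Lemma ltrN_half_dist (p u v : R) : u < p / 2 -> - (p / 2) < v -> - p < v - u.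
Proof. by lra. Qed.

Lemma ordered_ac_same_sign a b f : a <= b -> ordered_ac a b f ->
  (forall x, a <= x <= b -> f x != 0) -> 0 < f a * f b.
Proof.
move=> ab acf f0; rewrite ltNge; apply/negP => fab.
have [||c] := @IVT R (f \o clamp a b) a b 0 ab.
- by apply: continuous_subspaceT; exact: ordered_ac_continuous_clamp.
- rewrite /= !clamp_id ?lexx ?ab//.
  by rewrite ge_min le_max; case: (lerP (f a) 0) => fa; case: (lerP (f b) 0) => fb //=; nra.
by rewrite in_itv/= => cab; rewrite clamp_id//; apply/eqP; exact: f0.
Qed.

Notation integrable_on a b f := ((@leb R).-integrable `[a, b] (EFin \o f)).

Lemma integrable_onD a b f g : integrable_on a b f -> integrable_on a b g ->
  integrable_on a b (fun x => f x + g x).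
Proof.
have -> : EFin \o (fun x => f x + g x) = ((EFin \o f) \+ (EFin \o g))%E by [].
by apply: integrableD; exact: measurable_itv_completed.
Qed.

Lemma integrable_onN a b f : integrable_on a b f -> integrable_on a b (fun x => - f x).
Proof.
have -> : EFin \o (fun x => - f x) = (-%E \o (EFin \o f))%E by [].
exact: integrableN.
Qed.

Lemma integrable_onB a b f g : integrable_on a b f -> integrable_on a b g ->
  integrable_on a b (fun x => f x - g x).
Proof. by move=> intf intg; apply: integrable_onD => //; exact: integrable_onN. Qed.

Lemma integrable_on_cst a b (k : R) : integrable_on a b (fun=> k).
Proof.
have muab : (@lebesgue_measure R `[a, b]%classic < +oo)%E.
  by rewrite lebesgue_measure_itv/=; case: ifP; rewrite ?ltry.
apply: integrable_completed; first exact: measurable_itv.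
apply: measurable_bounded_integrable.
- exact: measurable_itv.
- exact: muab.
- exact: measurable_cst.
exists `|k|; split; first exact: num_real.
by move=> M kM x _ /=; exact: ltW.
Qed.

Lemma integrable_on_sum a b (I : Type) (r : seq I) (P : pred I) (f : I -> R -> R) :
  (forall i, P i -> integrable_on a b (f i)) ->
  integrable_on a b (fun x => \sum_(i <- r | P i) f i x).
Proof.
move=> intf; elim: r => [|i r IH].
  have -> : (fun x => \sum_(i <- [::] | P i) f i x) = cst 0.
    by apply/funext => x; rewrite big_nil.
  exact: integrable_on_cst.
have -> : (fun x => \sum_(i <- i :: r | P i) f i x) =
    (if P i then fun x => f i x + \sum_(i <- r | P i) f i x
     else fun x => \sum_(i <- r | P i) f i x).
  by apply/funext => x; rewrite big_cons; case: ifP.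
by case: ifP => // Pi; apply: integrable_onD => //; exact: intf.
Qed.

Lemma integrable_on_min a b f g : a <= b -> integrable_on a b f -> integrable_on a b g ->
  integrable_on a b (fun x => Num.min (f x) (g x)).
Proof.
move=> ab intf intg.
have -> : (fun x => Num.min (f x) (g x)) = (fun x => (f x + g x - `|f x - g x|) / 2).
  by apply/funext => x; rewrite minr_absE.
apply: integrable_mul_ac (ordered_ac_cst _ _ _) => //.
apply: integrable_onB; first exact: integrable_onD.
have -> : EFin \o (fun x => `|f x - g x|) =
    (abse \o (EFin \o (fun x => f x - g x)%R))%E by [].
by apply: integrable_abse; exact: integrable_onB.
Qed.

Lemma is_derive_sum_cond x (I : Type) (r : seq I) (P : pred I) (f : I -> R -> R)
    (df : I -> R) :
  (forall i, P i -> is_derive x (1 : R) (f i) (df i)) ->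
  is_derive x (1 : R) (fun y => \sum_(i <- r | P i) f i y) (\sum_(i <- r | P i) df i).
Proof.
move=> derf; elim: r => [|i r IH].
  have -> : (fun y => \sum_(i <- [::] | P i) f i y) = cst 0.
    by apply/funext => y; rewrite big_nil.
  by rewrite big_nil; exact: is_derive_cst.
have -> : (fun y => \sum_(i <- i :: r | P i) f i y) =
    (if P i then fun y => f i y + \sum_(i <- r | P i) f i y
     else fun y => \sum_(i <- r | P i) f i y).
  by apply/funext => y; rewrite big_cons; case: ifP.
rewrite big_cons; case: ifP => // Pi.
by apply: is_deriveD => //; exact: derf.
Qed.

Lemma ae_on_forall (I : finType) (P : pred I) (D : set R) (Q : I -> R -> Prop) :
  (forall i, P i -> ae_on D (Q i)) -> ae_on D (fun x => forall i, P i -> Q i x).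
Proof.
move=> aeQ.
have : {ae (@leb R), forall x, forall i, D x -> P i -> Q i x}.
  apply: (filter_forall (ae_filter_ringOfSetsType (@leb R))) => i.
  have [Pi|NPi] := boolP (P i).
    apply: (@filterS _ _ (ae_filter_ringOfSetsType (@leb R))) (aeQ i Pi).
    by move=> x QDx Dx _; exact: QDx.
  by apply: aeW => x _.
apply: (@filterS _ _ (ae_filter_ringOfSetsType (@leb R))).
by move=> x Qx Dx i; exact: Qx.
Qed.

End closure_properties.

(** * The Riccati equation of the system *)

Section riccati.
Context {R : realType} {n : nat} (hn : (3 <= n)%N) (t0 : R).
Implicit Types (j k : 'I_n) (s t x y : R).
Context (a : 'I_n -> 'I_n -> R -> R) (q : 'I_n -> R -> R).
Notation "1'" := (idx1 hn).
Notation "2'" := (idx2 hn).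
Notation integrable_on x y f := ((@leb R).-integrable `[x, y] (EFin \o f)).

Lemma sum_split12 (F : 'I_n -> R) :
  \sum_(k < n) F k = F 1' + F 2' + \sum_(k < n | (2 <= k)%N) F k.
Proof.
rewrite (bigD1 1')//= (bigD1 2')//= addrA; congr (_ + _).
by apply: eq_bigl => -[[|[|k]] hk].
Qed.

(** Exchanging the double sum brings the terms in [B_k] to the shape they have in the derivative of
    the quasi-derivative. *)
Lemma sum_funB (t : R) (phi : 'I_n -> R) :
  \sum_(k < n | (2 <= k)%N) funB hn a q k t * phi k =
  a 2' 2' t * (\sum_(k < n | (2 <= k)%N) q k t * phi k)
  - \sum_(k < n | (2 <= k)%N) a 2' k t * phi k
  - \sum_(k < n | (2 <= k)%N) derive1 (q k) t * phi k
  - \sum_(j < n | (2 <= j)%N) q j t * (\sum_(k < n | (2 <= k)%N) a j k t * phi k)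
  + (\sum_(j < n | (2 <= j)%N) q j t * a j 2' t) *
    (\sum_(k < n | (2 <= k)%N) q k t * phi k).
Proof.
have -> : \sum_(j < n | (2 <= j)%N) q j t * (\sum_(k < n | (2 <= k)%N) a j k t * phi k)
    = \sum_(k < n | (2 <= k)%N) (\sum_(j < n | (2 <= j)%N) q j t * a j k t) * phi k.
  under eq_bigr do rewrite mulr_sumr.
  rewrite exchange_big/=; apply: eq_bigr => k _; rewrite mulr_suml.
  by apply: eq_bigr => j _; rewrite mulrA.
rewrite !mulr_sumr -!sumrB -big_split/=; apply: eq_bigr => k _.
have -> : funB hn a q k t = a 2' 2' t * q k t - a 2' k t - derive1 (q k) t
    - (\sum_(j < n | (2 <= j)%N) q j t * a j k t
       - (\sum_(j < n | (2 <= j)%N) q j t * a j 2' t) * q k t).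
  rewrite /funB; congr (_ - _); rewrite mulr_suml -sumrB; apply: eq_bigr => j _.
  ring.
ring.
Qed.

Context (a_int : forall j k, loc_integrable t0 (a j k)).
Context (q_rel : forall k : 'I_n, (2 <= k)%N ->
  well_defined_relation t0 (a 1' k) (a 1' 2') (q k)).
Context (q_ac : forall k : 'I_n, (2 <= k)%N -> loc_abs_continuous t0 (q k)).

Lemma q_ordered_ac k x y : (2 <= k)%N -> t0 <= x -> x <= y -> ordered_ac x y (q k).
Proof.
move=> k2 tx xy; apply: (@ordered_acS _ t0 y) => //.
by apply: abs_continuous_ordered; apply: q_ac => //; exact: le_trans xy.
Qed.

Lemma a_integrable j k x y : t0 <= x -> x <= y -> integrable_on x y (a j k).
Proof.
by move=> tx xy; apply: (@integrableS_itv _ t0 y) => //; apply: a_int; exact: le_trans xy.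
Qed.

Lemma q_mul_integrable j k x y : (2 <= j)%N -> t0 <= x -> x <= y ->
  integrable_on x y (fun t => q j t * a j k t).
Proof.
move=> j2 tx xy.
have -> : (fun t => q j t * a j k t) = (fun t => a j k t * q j t).
  by apply/funext => t; rewrite mulrC.
by apply: integrable_mul_ac => //; [exact: a_integrable|exact: q_ordered_ac].
Qed.

Lemma funA_integrable x y : t0 <= x -> x <= y -> integrable_on x y (funA hn a q).
Proof.
move=> tx xy; apply: integrable_onB.
  by apply: integrable_onB; exact: a_integrable.
by apply: integrable_on_sum => j j2; exact: q_mul_integrable.
Qed.

Lemma funC_integrable x y : t0 <= x -> x <= y -> integrable_on x y (funC hn a q).
Proof.
move=> tx xy; apply: integrable_onB.
  by apply: integrable_onN; exact: a_integrable.
by apply: integrable_on_sum => j j2; exact: q_mul_integrable.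
Qed.

Definition intA (s t : R) : R := \int[@leb R]_(tau in `[s, t]) funA hn a q tau.

Lemma intA_ordered_ac s x y : t0 <= s -> s <= x -> x <= y -> ordered_ac x y (intA s).
Proof.
move=> ts sx xy; apply: (@ordered_acS _ s y) => //.
have [] // := @ordered_ac_integral_completed _ s y (funA hn a q).
by apply: funA_integrable => //; exact: le_trans xy.
Qed.

Lemma is_derive_intA s x y : t0 <= s -> s <= x -> x <= y ->
  ae_on `[x, y] (fun t => is_derive t (1 : R) (intA s) (funA hn a q t)).
Proof.
move=> ts sx xy; apply: (@ae_on_subset _ `[s, y]); first exact: subset_itvr.
have [] // := @ordered_ac_integral_completed _ s y (funA hn a q).
by apply: funA_integrable => //; exact: le_trans xy.
Qed.

Lemma weightP_integrable s x y : t0 <= s -> s <= x -> x <= y ->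
  integrable_on x y (weightP hn a q s).
Proof.
move=> ts sx xy; apply: integrable_mul_ac => //.
  by apply: a_integrable => //; exact: le_trans sx.
apply: ordered_ac_expR => //.
apply: (@ordered_ac_lip _ x y (intA s) _ 1) => //; last exact: intA_ordered_ac.
by move=> u v _ _; rewrite mul1r -opprD normrN.
Qed.

Lemma weightQ_integrable s x y : t0 <= s -> s <= x -> x <= y ->
  integrable_on x y (weightQ hn a q s).
Proof.
move=> ts sx xy; apply: integrable_mul_ac => //.
  by apply: funC_integrable => //; exact: le_trans sx.
by apply: ordered_ac_expR => //; exact: intA_ordered_ac.
Qed.

Context (phi : 'I_n -> R -> R) (sol : is_solution t0 a phi).

Lemma solution_ordered_ac j x y : t0 <= x -> x <= y -> ordered_ac x y (phi j).
Proof.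
move=> tx xy; apply: (@ordered_acS _ t0 y) => //.
by apply: abs_continuous_ordered; apply: sol.1; exact: le_trans xy.
Qed.

(* On the solution, [phi_1' = a_11 phi_1 + a_12 quasi_derivative]. *)
Definition quasi_derivative (t : R) : R :=
  phi 2' t + \sum_(k < n | (2 <= k)%N) q k t * phi k t.

(** The quotient of [quasi_derivative] by [phi_1] satisfies a Riccati equation with linear term
    [- A y]; the exponential factor removes that term. *)
Definition riccati_fun (s t : R) : R :=
  quasi_derivative t * (phi 1' t)^-1 * expR (intA s t).

Lemma quasi_derivative_ordered_ac x y : t0 <= x -> x <= y ->
  ordered_ac x y quasi_derivative.
Proof.
move=> tx xy; apply: ordered_acD; first exact: solution_ordered_ac.
apply: ordered_ac_sum => k k2; apply: ordered_acM => //.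
  exact: q_ordered_ac.
exact: solution_ordered_ac.
Qed.

Lemma riccati_fun_ordered_ac s x y : t0 <= s -> s <= x -> x <= y ->
  (forall t, x <= t <= y -> phi 1' t != 0) -> ordered_ac x y (riccati_fun s).
Proof.
move=> ts sx xy phi0; have tx : t0 <= x by exact: le_trans sx.
apply: ordered_acM => //; last first.
  by apply: ordered_ac_expR => //; exact: intA_ordered_ac.
apply: ordered_acM => //; first exact: quasi_derivative_ordered_ac.
by apply: ordered_acV => //; exact: solution_ordered_ac.
Qed.

(** Absolute continuity gives differentiability almost everywhere, and at such points [derive1] is
    the true derivative. *)
Lemma is_derive_q x y : t0 <= x -> x < y -> ae_on `[x, y] (fun t =>
  forall k : 'I_n, (2 <= k)%N -> is_derive t (1 : R) (q k) (derive1 (q k) t)).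
Proof.
move=> tx xy; apply: ae_on_forall => k k2.
have [rho [_ + _]] := ordered_ac_ftc xy (q_ordered_ac k2 tx (ltW xy)).
apply: ae_onS => t _ dq; rewrite derive1E.
by apply: DeriveDef => //; case: dq.
Qed.

(** Almost every point satisfies at once the equations of the system, the relations
    [a_1k = q_k a_12] and the differentiability of [q_k] and of the integral of [A]. At such a point
    the claim is algebra. *)
Lemma riccati_equation s x y : t0 <= s -> s <= x -> x < y ->
  (forall t, x <= t <= y -> phi 1' t != 0) ->
  ae_on `[x, y] (fun t => is_derive t (1 : R) (riccati_fun s)
    (- weightP hn a q s t * riccati_fun s t ^+ 2 - weightQ hn a q s t
     - expR (intA s t) * (\sum_(k < n | (2 <= k)%N) funB hn a q k t * phi k t) / phi 1' t)).
Proof.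
move=> ts sx xy phi0; have tx : t0 <= x by exact: le_trans sx.
have xyt0 : `[x, y] `<=` `[t0, +oo[.
  by move=> t; rewrite /= !in_itv/= => /andP[xt _]; rewrite (le_trans tx).
have dphi : ae_on `[x, y] (fun t => forall j : 'I_n, true ->
    is_derive t (1 : R) (phi j) (\sum_(k < n) a j k t * phi k t)).
  by apply: ae_on_forall => j _; exact: ae_on_subset xyt0 (sol.2 j).
have aq : ae_on `[x, y] (fun t => forall k : 'I_n, (2 <= k)%N ->
    a 1' k t = q k t * a 1' 2' t).
  by apply: ae_on_forall => k k2; have [_ _] := q_rel k2; exact: ae_on_subset.
have dq := is_derive_q tx xy.
have dJ := is_derive_intA ts sx (ltW xy).
have := ae_onS2 (fun t _ h1 h2 => conj h1 h2) dq dJ.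
apply: ae_onS2 (ae_onS2 (fun t _ h1 h2 => conj h1 h2) dphi aq).
move=> t; rewrite /= in_itv/= => xty [{}dphi {}aq] [{}dq {}dJ].
have p0 := phi0 t xty.
have d1 := dphi 1' isT; have d2 := dphi 2' isT.
have dpsi : is_derive t (1 : R) quasi_derivative
    (\sum_(k < n) a 2' k t * phi k t + \sum_(j < n | (2 <= j)%N)
       (q j t * (\sum_(k < n) a j k t * phi k t) + phi j t * derive1 (q j) t)).
  apply: is_deriveD; apply: is_derive_sum_cond => j j2.
  by apply: is_deriveM; [exact: dq|exact: dphi].
have dinv := is_deriveV p0 d1.
have dexp : is_derive t (1 : R) (fun t => expR (intA s t)) (expR (intA s t) * funA hn a q t).
  exact: is_derive1_comp (is_derive_expR _) dJ.
(* The derivative is first produced in the form given by the product rule, then matched with the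
   stated one. *)
have dw : is_derive t (1 : R) (riccati_fun s) _ := is_deriveM (is_deriveM dpsi dinv) dexp.
apply: is_derive_eq dw _.
rewrite mulrfctE /GRing.scale/=.
rewrite /riccati_fun /weightP /weightQ -!/(intA s t) expRN sum_funB /funA /funC.
have E0 : expR (intA s t) != 0 by rewrite gt_eqF// expR_gt0.
set X := \sum_(k < n | (2 <= k)%N) q k t * phi k t.
have -> : quasi_derivative t = phi 2' t + X by [].
(* Here the relations [a_1k = q_k a_12] enter: the first equation becomes
   [phi_1' = a_11 phi_1 + a_12 psi]. *)
have -> : \sum_(k < n) a 1' k t * phi k t =
    a 1' 1' t * phi 1' t + a 1' 2' t * (phi 2' t + X).
  rewrite sum_split12 mulrDr addrA; congr (_ + _); rewrite /X mulr_sumr.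
  by apply: eq_bigr => k k2; rewrite aq//; ring.
have -> : \sum_(j < n | (2 <= j)%N)
    (q j t * (\sum_(k < n) a j k t * phi k t) + phi j t * derive1 (q j) t) =
    (\sum_(j < n | (2 <= j)%N) q j t * a j 1' t) * phi 1' t
    + (\sum_(j < n | (2 <= j)%N) q j t * a j 2' t) * phi 2' t
    + \sum_(j < n | (2 <= j)%N) q j t * (\sum_(k < n | (2 <= k)%N) a j k t * phi k t)
    + \sum_(k < n | (2 <= k)%N) derive1 (q k) t * phi k t.
  rewrite !mulr_suml -!big_split/=; apply: eq_bigr => j _.
  by rewrite sum_split12; ring.
rewrite sum_split12.
by field; rewrite p0 E0.
Qed.

End riccati.


(** * The two oscillation criteria *)

Section oscillation.
Context {R : realType} {n : nat} (hn : (3 <= n)%N) (t0 : R).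
Implicit Types (f : R -> R) (s t x y : R).
Notation "1'" := (idx1 hn).
Notation "2'" := (idx2 hn).
Notation integrable_on x y f := ((@leb R).-integrable `[x, y] (EFin \o f)).

Lemma not_arbitrarily_large_zeroes f : ~ arbitrarily_large_zeroes t0 f ->
  exists2 T, t0 <= T & forall t, T <= t -> f t != 0.
Proof.
move=> /existsNP[T /not_implyP[tT noz]]; exists T => // t Tt.
by apply: contra_notN noz => /eqP ft; exists t.
Qed.

Lemma RintegralN x y f : integrable_on x y f ->
  \int[@leb R]_(t in `[x, y]) (- f t) = - \int[@leb R]_(t in `[x, y]) f t.
Proof.
move=> intf; rewrite -mulN1r -RintegralZl//; last exact: measurable_itv_completed.
by apply: eq_Rintegral => t _; rewrite mulN1r.
Qed.

Context (a : 'I_n -> 'I_n -> R -> R) (q : 'I_n -> R -> R).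
Context (a_int : forall j k, loc_integrable t0 (a j k)).
Context (q_rel : forall k : 'I_n, (2 <= k)%N ->
  well_defined_relation t0 (a 1' k) (a 1' 2') (q k)).
Context (q_ac : forall k : 'I_n, (2 <= k)%N -> loc_abs_continuous t0 (q k)).
Context (a12_ge0 : forall t, t0 <= t -> 0 <= a 1' 2' t).

Lemma suboscillation :
  (forall T (sigma : 'I_n -> bool), t0 <= T -> exists t1 t2 : R,
     [/\ T <= t1, t1 < t2,
       forall k : 'I_n, (2 <= k)%N ->
         ae_on `[t1, t2] (fun t => 0 <= (-1) ^+ sigma k * funB hn a q k t) &
       pi <= \int[@leb R]_(t in `[t1, t2])
               Num.min (weightP hn a q t1 t) (weightQ hn a q t1 t)]) ->
  suboscillatory hn t0 a.
Proof.
move=> H phi sol; apply: contrapT => nosub.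
(* The largest of the finitely many thresholds works for all components except the second. *)
have [T tT phi0] : exists2 T, t0 <= T &
    forall j, j != 2' -> forall t, T <= t -> phi j t != 0.
  have /choice[S SP] : forall j, exists Tj, t0 <= Tj /\
      (j != 2' -> forall t, Tj <= t -> phi j t != 0).
    move=> j; have [->|j2] := eqVneq j 2'; first by exists t0.
    have [|T tT phi0] := @not_arbitrarily_large_zeroes (phi j); last by exists T.
    by move=> zj; apply: nosub; exists j.
  exists (\big[Num.max/t0]_j S j).
    by apply: le_trans (SP 1').1 _; exact: le_bigmax.
  by move=> j j2 t St; apply: (SP j).2 => //; apply: le_trans St; exact: le_bigmax.
have neq2 k : (2 <= k)%N -> k != 2'.
  by move=> k2; apply/eqP => kE; move: k2; rewrite kE.
have same j t : j != 2' -> T <= t -> 0 < phi j T * phi j t.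
  move=> j2 Tt; apply: ordered_ac_same_sign => //.
    exact: (solution_ordered_ac sol j tT Tt).
  by move=> x /andP[Tx _]; exact: phi0.
(* The sign [sigma k] records whether [phi_k] and [phi_1] have opposite signs at [T], hence at all
   later times. *)
have [t1 [t2 [Tt1 t12 HB Hpi]]] := H T (fun k => phi k T * phi 1' T < 0) tT.
have tt1 : t0 <= t1 by exact: le_trans Tt1.
have phi1 t : t1 <= t <= t2 -> phi 1' t != 0.
  by move=> /andP[t1t _]; apply: phi0 => //; exact: le_trans t1t.
pose w := riccati_fun hn a q phi t1.
have intP := weightP_integrable hn a_int q_ac tt1 (lexx t1) (ltW t12).
have intQ := weightQ_integrable hn a_int q_ac tt1 (lexx t1) (ltW t12).
have intm := integrable_on_min (ltW t12) intP intQ.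
have acw : ordered_ac t1 t2 w.
  exact: (riccati_fun_ordered_ac a_int q_ac sol tt1 (lexx t1) (ltW t12) phi1).
have dw := riccati_equation a_int q_rel q_ac sol tt1 (lexx t1) t12 phi1.
have : atan (w t2) - atan (w t1) <= \int[@leb R]_(t in `[t1, t2])
    (- Num.min (weightP hn a q t1 t) (weightQ hn a q t1 t)).
  apply: (@ordered_ac_le_integral _ t1 t2 (atan \o w)) => //.
  - exact: ordered_ac_atan.
  - exact: integrable_onN.
  apply: ae_onS2 dw (ae_on_forall HB) => t; rewrite /= in_itv/= => /andP[t1t tt2].
  move=> dw BB; have Tt : T <= t by exact: le_trans t1t.
  set W := expR _ * _ / _ in dw.
  (* Each [B_k] has the sign of [phi_k / phi_1], so the coupling term of the Riccati equation is
     nonnegative. *)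
  have W0 : 0 <= W.
    rewrite /W -mulrA mulr_ge0 ?expR_ge0// mulr_suml sumr_ge0// => k k2.
    have p1 := phi1 t; rewrite t1t tt2 in p1; have {}p1 := p1 isT.
    have -> : funB hn a q k t * phi k t / phi 1' t =
        (phi 1' t) ^- 2 * (funB hn a q k t * (phi k t * phi 1' t)) by field.
    rewrite mulr_ge0 ?invr_ge0 ?sqr_ge0//.
    have := BB k k2; have := same k t (neq2 k k2) Tt; have := same 1' t isT Tt.
    have -> : phi 1' T * phi 1' t = phi 1' t * phi 1' T by rewrite mulrC.
    move=> s1 sk; have := mulr_gt0 s1 sk.
    (* Regrouped in this way, the positive product shows that [phi_k phi_1] has the same sign at [t]
       as at [T]. *)
    have -> : phi 1' t * phi 1' T * (phi k T * phi k t) =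
       (phi k T * phi 1' T) * (phi k t * phi 1' t) by ring.
    case: (ltP (phi k T * phi 1' T) 0) => kT /= pr; rewrite ?expr1 ?expr0 => BBk.
      move: pr; rewrite nmulr_rgt0// => r0.
      by rewrite mulr_le0 ?(ltW r0)//; move: BBk; rewrite mulN1r oppr_ge0.
    have p0 : 0 < phi k T * phi 1' T.
      by rewrite lt_neqAle kT andbT; apply: contraTneq pr => <-; rewrite mul0r ltxx.
    move: pr; rewrite pmulr_rgt0// => r0.
    by rewrite mulr_ge0 ?(ltW r0)//; move: BBk; rewrite mul1r.
  exists ((1 + w t ^+ 2)^-1 *
      (- weightP hn a q t1 t * w t ^+ 2 - weightQ hn a q t1 t - W)).
    exact: is_derive1_comp (is_derive1_atan _) dw.
  have w20 : 0 <= w t ^+ 2 by exact: sqr_ge0.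
  (* With [m] the minimum, the claim is [- P w^2 - Q - W <= - m (1 + w^2)]. *)
  rewrite mulrC ler_pdivrMr ?ltr_wpDr//.
  set m := Num.min _ _; have mP : m <= weightP hn a q t1 t by rewrite ge_min lexx.
  have mQ : m <= weightQ hn a q t1 t by rewrite ge_min lexx orbT.
  by nra.
rewrite RintegralN// => /le_trans h.
have {}h : atan (w t2) - atan (w t1) <= - pi by apply: h; rewrite lerN2.
(* Arctangents lie strictly between [- pi / 2] and [pi / 2], so a drop of [pi] is impossible. *)
by move: h; rewrite leNgt ltrN_half_dist ?atan_ltpi2 ?atan_gtNpi2.
Qed.

Lemma oscillation :
  (forall k : 'I_n, (2 <= k)%N -> ae_on `[t0, +oo[ (fun t => funB hn a q k t = 0)) ->
  (\int[@leb R]_(t in `[t0, T]) weightP hn a q t0 t) @[T --> +oo] --> +oo ->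
  (\int[@leb R]_(t in `[t0, T]) weightQ hn a q t0 t) @[T --> +oo] --> +oo ->
  oscillatory hn t0 a.
Proof.
move=> HB /cvgryPge HP /cvgryPge HQ phi sol; apply: contrapT.
move=> /not_arbitrarily_large_zeroes[T tT phi0].
pose P := weightP hn a q t0; pose Q := weightQ hn a q t0.
pose IP x := \int[@leb R]_(t in `[t0, x]) P t.
pose IQ x := \int[@leb R]_(t in `[t0, x]) Q t.
pose w := riccati_fun hn a q phi t0.
(* The integral starts at [T], from where [phi_1] has no zero and [w] is absolutely continuous. *)
pose U x := \int[@leb R]_(t in `[T, x]) (P t * (w t * w t)).
have P0 t : t0 <= t -> 0 <= P t by move=> tt; rewrite mulr_ge0 ?expR_ge0 ?a12_ge0.
have U0 x : 0 <= U x.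
  apply: Rintegral_ge0 => t; rewrite /= in_itv/= => /andP[Tt _].
  by rewrite mulr_ge0 ?P0 ?(le_trans tT)// -expr2 sqr_ge0.
have phi1 y t : T <= t <= y -> phi 1' t != 0 by move=> /andP[? _]; exact: phi0.
have acw y : T <= y -> ordered_ac T y w.
  move=> Ty; exact: (riccati_fun_ordered_ac a_int q_ac sol (lexx t0) tT Ty (phi1 y)).
have facP y : t0 <= y -> ordered_ac t0 y IP /\
    ae_on `[t0, y] (fun x => is_derive x (1 : R) IP (P x)).
  move=> ty; apply: ordered_ac_integral_completed.
  exact: (weightP_integrable hn a_int q_ac (lexx t0) (lexx t0) ty).
have facQ y : t0 <= y -> ordered_ac t0 y IQ /\
    ae_on `[t0, y] (fun x => is_derive x (1 : R) IQ (Q x)).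
  move=> ty; apply: ordered_ac_integral_completed.
  exact: (weightQ_integrable hn a_int q_ac (lexx t0) (lexx t0) ty).
have facU y : T <= y -> ordered_ac T y U /\
    ae_on `[T, y] (fun x => is_derive x (1 : R) U (P x * (w x * w x))).
  move=> Ty; apply: ordered_ac_integral_completed; apply: integrable_mul_ac => //.
    exact: (weightP_integrable hn a_int q_ac (lexx t0) tT Ty).
  by apply: ordered_acM => //; exact: acw.
(* With every [B_k] zero, the Riccati equation says that the sum [w + U + IQ] has zero derivative
   almost everywhere. *)
have wE y : T < y -> w y + U y + IQ y = w T + U T + IQ T.
  move=> Ty; apply/eqP; rewrite -subr_eq0; apply/eqP.
  have [acU dU] := facU y (ltW Ty).
  have [acQ dQ] := facQ y (le_trans tT (ltW Ty)).
  have Tyt0 : `[T, y] `<=` `[t0, +oo[.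
    by move=> t; rewrite /= !in_itv/= => /andP[Tt _]; rewrite (le_trans tT).
  have dB := ae_on_subset Tyt0 (ae_on_forall HB).
  have dw := riccati_equation a_int q_rel q_ac sol (lexx t0) tT Ty (phi1 y).
  have {}dQ : ae_on `[T, y] (fun x => is_derive x (1 : R) IQ (Q x)).
    by apply: ae_on_subset dQ; exact: subset_itvr.
  rewrite (@ordered_ac_eq_integral _ T y (fun x => w x + U x + IQ x) (fun=> 0))//.
  - by rewrite Rintegral_cst ?mul0r//; exact: measurable_itv_completed.
  - apply: ordered_acD; first by apply: ordered_acD => //; exact: acw (ltW Ty).
    exact: ordered_acS acQ.
  - exact: integrable_on_cst.
  apply: ae_onS2 (ae_onS2 (fun t _ h1 h2 => conj h1 h2) dB dw)
    (ae_onS2 (fun t _ h1 h2 => conj h1 h2) dU dQ).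
  move=> t _ [B0 {}dw] [{}dU {}dQ].
  apply: is_derive_eq (is_deriveD (is_deriveD dw dU) dQ) _.
  rewrite big1 => [|k k2]; last by rewrite B0 ?mul0r.
  by rewrite -/P -/Q -/w; ring.
pose K := w T + U T + IQ T.
(* Past [T1] the conserved quantity [K] forces [w + U <= -1]. The [+ 1] in the witness turns the
   strict threshold of the limit into a weak one. *)
have [T1 TT1 HT1] : exists2 T1, T < T1 & forall t, T1 <= t -> K + 1 <= IQ t.
  have [M [_ HM]] := HQ (K + 1); exists (Num.max M T + 1).
    by rewrite (@le_lt_trans _ _ (Num.max M T)) ?ltrDl// le_max lexx orbT.
  move=> t Mt; apply: HM; apply: lt_le_trans Mt.
  by rewrite (@le_lt_trans _ _ (Num.max M T)) ?ltrDl// le_max lexx.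
(* The integral of [P] over [T1, M] is at least 2, while [(1 + U)^-1] stays between 0 and 1 and can
   drop by at most 1. *)
have [M T1M HM] : exists2 M, T1 < M & IP T1 + 2 <= IP M.
  have [M [_ HM]] := HP (IP T1 + 2); exists (Num.max M T1 + 1).
    by rewrite (@le_lt_trans _ _ (Num.max M T1)) ?ltrDl// le_max lexx orbT.
  by apply: HM; rewrite (@le_lt_trans _ _ (Num.max M T1)) ?ltrDl// le_max lexx.
have tT1 : t0 <= T1 by rewrite (le_trans tT)// ltW.
have [acP dP] := facP M (le_trans tT1 (ltW T1M)).
have [acU dU] := facU M (ltW (lt_trans TT1 T1M)).
have intP : integrable_on T1 M P.
  exact: (weightP_integrable hn a_int q_ac (lexx t0) tT1 (ltW T1M)).
have IPE : IP M - IP T1 = \int[@leb R]_(t in `[T1, M]) P t.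
  apply: ordered_ac_eq_integral => //; first exact: ordered_acS acP.
  by apply: ae_on_subset dP; exact: subset_itvr.
have : (1 + U M)^-1 - (1 + U T1)^-1 <= \int[@leb R]_(t in `[T1, M]) (- P t).
  apply: (@ordered_ac_le_integral _ T1 M (fun x => (1 + U x)^-1)) => //.
  - apply: (@ordered_acS _ T M) => //; first exact: ltW.
    apply: ordered_acV; first exact: ltW (lt_trans TT1 T1M).
      by apply: ordered_acD => //; exact: ordered_ac_cst.
    by move=> x _; rewrite gt_eqF// ltr_wpDr.
  - exact: integrable_onN.
  have {}dU : ae_on `[T1, M] (fun x => is_derive x (1 : R) U (P x * (w x * w x))).
    by apply: ae_on_subset dU; apply: subset_itvr; rewrite bnd_simp ltW.
  apply: ae_onS dU => t; rewrite /= in_itv/= => /andP[T1t tM] dU.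
  have u0 : 1 + U t != 0 by rewrite gt_eqF// ltr_wpDr.
  (* This derivative of [(1 + U)^-1] is at most [- P], because [- w >= 1 + U > 0] gives
     [w^2 >= (1 + U)^2]. *)
  exists (- (1 + U t) ^- 2 * (0 + P t * (w t * w t))).
    have d1U := is_deriveD (is_derive_cst (1 : R) t (1 : R)) dU.
    exact: (@is_deriveV _ (fun x => 1 + U x) _ _ _ u0 d1U).
  rewrite add0r mulNr lerN2 mulrC ler_pdivlMr; last by rewrite exprn_gt0// ltr_wpDr.
  apply: ler_wpM2l; first by apply: P0; exact: le_trans T1t.
  have {}wE := wE t (lt_le_trans TT1 T1t); rewrite -/K in wE.
  have wU : 1 + U t <= - w t.
    by move: wE (HT1 t T1t); clear; lra.
  by rewrite expr2 -[leRHS]mulrNN; apply: ler_pM => //; rewrite ?addr_ge0 ?U0//.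
rewrite RintegralN// -IPE => h.
have h1 : 0 <= (1 + U M)^-1 by rewrite invr_ge0 addr_ge0.
have h2 : (1 + U T1)^-1 <= 1 by rewrite invf_le1 ?lerDl// ltr_wpDr.
by move: HM h h1 h2; clear; lra.
Qed.

End oscillation.

Theorem theorem3p1 (R : realType) (n : nat) (hn : (3 <= n)%N) (t0 : R)
    (a : 'I_n -> 'I_n -> R -> R)
    (a_int : forall j k, loc_integrable t0 (a j k))
    (q : 'I_n -> R -> R)
    (q_rel : forall k : 'I_n, (2 <= k)%N ->
       well_defined_relation t0 (a (idx1 hn) k) (a (idx1 hn) (idx2 hn)) (q k))
    (q_ac : forall k : 'I_n, (2 <= k)%N -> loc_abs_continuous t0 (q k))
    (a12_ge0 : forall t : R, t0 <= t -> 0 <= a (idx1 hn) (idx2 hn) t) :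
  ((forall (T : R) (sigma : 'I_n -> bool), t0 <= T ->
      exists t1 t2 : R,
        [/\ T <= t1, t1 < t2,
            forall k : 'I_n, (2 <= k)%N ->
              ae_on `[t1, t2] (fun t => 0 <= (-1) ^+ sigma k * funB hn a q k t) &
            pi <= \int[@leb R]_(t in `[t1, t2])
                    Num.min (weightP hn a q t1 t) (weightQ hn a q t1 t)]) ->
   suboscillatory hn t0 a)
  /\
  ((forall k : 'I_n, (2 <= k)%N ->
      ae_on `[t0, +oo[ (fun t => funB hn a q k t = 0)) ->
   (\int[@leb R]_(t in `[t0, T]) weightP hn a q t0 t) @[T --> +oo] --> +oo ->
   (\int[@leb R]_(t in `[t0, T]) weightQ hn a q t0 t) @[T --> +oo] --> +oo ->
   oscillatory hn t0 a).
Proof.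
split.
- exact: suboscillation.
- exact: oscillation.
Qed.
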